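(* Let $n\ge1$ and let $X=(X_t)_{t\in[0,1]^n}$ be a real-valued random field whose increments have finite second moments, and suppose there are constants $C_0>0$ and $\iota\ge0$ such that for all $p\ge 1$ and all $s,t\in[0,1]^n$ $$\mathbb{E}|X_t-X_s|^p\le C_0^p\,p^{p\iota}\left[\mathbb{E}|X_t-X_s|^2\right]^{p/2}.$$ Let $\alpha>0$. Then $X$ (up to modification) is H\''older continuous of any order $\gamma<\alpha$, i.e. for any $\epsilon>0$ there is an almost surely finite random variable $C_\epsilon(\omega)$ such that almost surely, for all $s\ne t$ in $[0,1]^n$, $$|X_t-X_s|\le C_\epsilon(\omega)\|t-s\|^{\alpha-\epsilon},$$ if and only if for any $\epsilon>0$ there is a constant $C_\epsilon>0$ such that for all $s\ne t$ in $[0,1]^n$ $$\mathbb{E}(X_t-X_s)^2\le C_\epsilon\|t-s\|^{2\alpha-\epsilon}.$$ Moreover, in this case (if $\iota>0$) for every $\epsilon>0$ the H\''older constant $C_\epsilon(\omega)=\sup_{s\neq t}\frac{|X_t-X_s|}{\|t-s\|^{\alpha-\epsilon}}$ of $X$ satisfies $$\mathbb{E}\exp\left(\beta\,C_\epsilon(\omega)^{1/\iota}\right)<\infty$$ for small enough $\beta>0$ which depends only on $C_0$, $\alpha$, $\iota$, and $\epsilon$.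
   Context: $\|\cdot\|$ is the Euclidean norm on $\mathbb{R}^n$. A modification of $X$ is a field $\tilde X$ on the same probability space with $P(\tilde X_t=X_t)=1$ for every $t$. ''Up to modification'' means that $X$ has a modification, still denoted $X$, with the stated sample path property.
   Formalization: The bound on β may also depend on n and on the constant C_ε of the variance bound for the same ε: with C_0, α, ι, ε alone the claim fails, e.g. X_t = c t ξ, ξ Gaussian, n = 1, ι = 1/2, α = 1, c large. *)

(* Defs.v *)
From HB Require Import structures.
From mathcomp Require Import all_boot all_order all_algebra.
From mathcomp Require Import all_classical all_reals all_analysis.
(* not exported by all_analysis: the sigma-algebra of \bar R *)
From mathcomp Require Import measurable_realfun.

Set Implicit Arguments.
Unset Strict Implicit.
Unset Printing Implicit Defensive.

Import Order.TTheory GRing.Theory Num.Theory.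
Import numFieldNormedType.Exports.

Local Open Scope classical_set_scope.
Local Open Scope ring_scope.

(* The library's norm on 'rV[R]_n is the sup norm. *)
Definition enorm (R : realType) (n : nat) (v : 'rV[R]_n) : R :=
  Num.sqrt (\sum_(i < n) v ord0 i ^+ 2).

Definition cube (R : realType) (n : nat) : set 'rV[R]_n :=
  [set t : 'rV[R]_n | forall i, 0 <= t ord0 i <= 1].

(* A random field on [0,1]^n is a family indexed by all of R^n of which only
   the members indexed by the cube are ever used: every predicate below
   restricts its indices to [cube]. *)
Section fields.
Context (R : realType) (n : nat) (d : measure_display) (T : measurableType d)
  (P : probability T R).
Implicit Types (X Y : 'rV[R]_n -> {RV P >-> R}).

Definition increments_L2 X : Prop :=
  forall s t, cube s -> cube t ->
    ('E_P[fun w => (`|X t w - X s w| ^+ 2)%R] < +oo)%E.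

Definition hypercontractive X (C0 iota : R) : Prop :=
  forall (p : R) s t, 1 <= p -> cube s -> cube t ->
    ('E_P[fun w => (`|X t w - X s w| `^ p)%R] <=
     (C0 `^ p * p `^ (p * iota))%:E *
       'E_P[fun w => (`|X t w - X s w| ^+ 2)%R] `^ (p / 2))%E.

Definition modification X Y : Prop :=
  forall t, cube t -> P [set w | Y t w = X t w] = 1%E.

Definition holder_below Y (alpha : R) : Prop :=
  forall eps : R, 0 < eps ->
    exists C : {RV P >-> \bar R},
      {ae P, forall w, C w \is a fin_num} /\
      {ae P, forall w, forall s t, cube s -> cube t -> s <> t ->
        ((`|Y t w - Y s w|)%R%:E <=
         C w * (enorm (t - s) `^ (alpha - eps))%R%:E)%E}.

Definition variance_bound X (alpha eps K : R) : Prop :=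
  forall s t, cube s -> cube t -> s <> t ->
    ('E_P[fun w => ((X t w - X s w) ^+ 2)%R] <=
     (K * enorm (t - s) `^ (2 * alpha - eps))%:E)%E.

Definition holder_constant Y (gamma : R) (w : T) : \bar R :=
  ereal_sup [set (`|Y st.2 w - Y st.1 w| / enorm (st.2 - st.1) `^ gamma)%:E
            | st in [set st : 'rV[R]_n * 'rV[R]_n |
                      [/\ cube st.1, cube st.2 & st.1 <> st.2]]].

(* E exp (beta C^(1/iota)) < oo for C the Holder constant of Y.  An uncountable
   supremum need not be measurable on the null set where Y is irregular, and
   the library integral of a nonmeasurable function is only a lower integral;
   so the supremum is required to agree almost surely with a genuine (finite)
   random variable, whose exponential moment is then taken. *)
Definition holder_constant_exp_moment Y (gamma iota beta : R) : Prop :=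
  exists C : {RV P >-> R},
    {ae P, forall w, holder_constant Y gamma w = (C w)%:E} /\
    ('E_P[fun w => expR (beta * C w `^ iota^-1)%R] < +oo)%E.

End fields.

(* Main.v *)
(** Chaining on the dyadic grid: a bound B r^m (r < 1) on the increments between
    neighbours of every level m propagates to all close pairs, and the p-th
    moment of the best B is controlled by the sum over m of the p-th moments of
    all level-m increments, finite for p large by hypercontractivity; this gives
    Kolmogorov's theorem.  Conversely, almost sure Hoelder continuity bounds the
    increments in probability, and the equivalence of second and fourth moments
    turns this into a variance bound (Paley-Zygmund).
    For the exponential moment, the Hoelder constant is split at a level m: the
    finitely many increments on the level-m grid have moments (A p^iota)^p with A
    depending only on the data, and the fine scales contribute
    B rho^m (rho < 1), where the moments of B grow like (A' p^iota)^p with A'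
    depending on the field.  As m may depend on the field, the second part
    is absorbed, so that beta does not depend on A'. *)
Require Import Defs.
From HB Require Import structures.
From mathcomp Require Import all_boot all_order all_algebra.
From mathcomp Require Import all_classical all_reals all_analysis.
From mathcomp Require Import measurable_realfun.
From mathcomp Require Import zify ring lra.

Set Implicit Arguments.
Unset Strict Implicit.
Unset Printing Implicit Defensive.

Import Order.TTheory GRing.Theory Num.Theory.
Import numFieldNormedType.Exports.

Local Open Scope classical_set_scope.
Local Open Scope ring_scope.

(** * Dyadic points of the cube and rounding down to them *)

Section dyadic.
Context {R : realType} {n : nat}.
Implicit Types (m k : nat) (s t u v : 'rV[R]_n).

(** In the second part, the constant [K] given with [eps] controls standard deviations with exponent
    [alpha - eps/2], which may be negative, whereas chaining needs a positive exponent. That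
    exponent is therefore taken from the continuity of the field itself, turned back into a variance
    bound by the converse half of the equivalence. The constant of this bound is not controlled by
    the data, and this is how an [A'] depending on the field enters. Absorbing it makes the net as
    large as the field requires, which is harmless: the number of net pairs multiplies the p-th
    powers from outside, and the threshold on [beta] sees only what stands inside the power. *)

Definition grid_index m := {ffun 'I_n -> 'I_(2 ^ m).+1}.

Definition grid_point m (f : grid_index m) : 'rV[R]_n :=
  \row_i ((f i)%:R / 2 ^+ m).

Definition dyadic m u : Prop := exists f : grid_index m, u = grid_point f.

(** Closeness is measured coordinatewise, which suits rounding; the Euclidean norm enters only at
    the end, at the cost of a factor n. It is a boolean so that it can filter finite sums over pairs
    of grid points. *)
Definition dyclose m u v : bool :=
  [forall i, `|u ord0 i - v ord0 i| <= (2 ^+ m)^-1].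

Definition dyfloor m t : 'rV[R]_n :=
  \row_i ((Num.truncn (t ord0 i * 2 ^+ m))%:R / 2 ^+ m).

Lemma exp2_gt0 m : 0 < 2 ^+ m :> R.
Proof. exact: exprn_gt0. Qed.
Local Hint Resolve exp2_gt0 : core.

Lemma exp2_neq0 m : 2 ^+ m != 0 :> R.
Proof. by rewrite gt_eqF. Qed.
Local Hint Resolve exp2_neq0 : core.

Lemma inv_exp2_ge0 m : 0 <= (2 ^+ m)^-1 :> R.
Proof. by rewrite invr_ge0 ltW. Qed.

Lemma dyclose_sym m u v : dyclose m u v = dyclose m v u.
Proof. by apply: eq_forallb => i; rewrite distrC. Qed.

Lemma dyclose0 u v : cube u -> cube v -> dyclose 0 u v.
Proof.
move=> cu cv; apply/forallP => i; rewrite expr0 invr1.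
by have := cu i; have := cv i; rewrite ler_norml; lra.
Qed.

Lemma dyadic_cube m u : dyadic m u -> cube u.
Proof.
case=> f -> i; rewrite mxE divr_ge0 //= ler_pdivrMr // mul1r -natrX ler_nat.
by rewrite -ltnS.
Qed.

Lemma dyadicP m u :
  dyadic m u <-> cube u /\ forall i, exists a : nat, u ord0 i = a%:R / 2 ^+ m.
Proof.
split=> [du|[cu /choice [a ua]]].
  split; first exact: dyadic_cube du.
  by case: du => f -> i; exists (f i); rewrite mxE.
have ale i : (a i < (2 ^ m).+1)%N.
  rewrite ltnS; have /andP[_] := cu i.
  by rewrite ua ler_pdivrMr // mul1r -natrX ler_nat.
exists [ffun i => Ordinal (ale i)].
by apply/rowP => i; rewrite mxE ffunE /= ua.
Qed.

Lemma truncn_bounds (x : R) : 0 <= x ->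
  (Num.truncn x)%:R <= x /\ x < (Num.truncn x)%:R + 1.
Proof. by move=> /truncn_itv/andP[h1]; rewrite -natr1. Qed.

Lemma dyfloor_dyadic m t : cube t -> dyadic m (dyfloor m t).
Proof.
move=> ct; apply/dyadicP; split=> i; last first.
  by exists (Num.truncn (t ord0 i * 2 ^+ m)); rewrite mxE.
have /andP[t0 t1] := ct i.
rewrite mxE divr_ge0 //= ler_pdivrMr // mul1r.
have t0' : 0 <= t ord0 i * 2 ^+ m by rewrite mulr_ge0 // ltW.
have [+ _] := truncn_bounds t0'.
by move=> /le_trans; apply; rewrite ler_piMl // ltW.
Qed.

Lemma dyadic_le m k u : (m <= k)%N -> dyadic m u -> dyadic k u.
Proof.
move=> mk /dyadicP [cu ua]; apply/dyadicP; split=> // i.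
have [a ->] := ua i; exists (a * 2 ^ (k - m))%N.
rewrite natrM natrX -{2}(subnK mk) exprD.
by rewrite invfM mulrA mulfK.
Qed.

Lemma dyadic_dyfloor m u : dyadic m u -> dyfloor m u = u.
Proof.
move=> [f ->]; apply/rowP => i; rewrite !mxE.
by rewrite divfK // natrK.
Qed.

Lemma dyfloor_close m t : cube t -> dyclose m (dyfloor m t) t.
Proof.
move=> ct; apply/forallP => i; rewrite mxE.
have /andP[t0 t1] := ct i.
have t0' : 0 <= t ord0 i * 2 ^+ m by rewrite mulr_ge0 // ltW.
have [h1 h2] := truncn_bounds t0'.
rewrite -{2}[t ord0 i](@mulfK _ (2 ^+ m)) // -mulrBl normrM.
rewrite [`|_^-1|]gtr0_norm ?invr_gt0 // -[leRHS]mul1r.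
rewrite ler_wpM2r ?inv_exp2_ge0 //.
by rewrite ler_norml; lra.
Qed.

(** Integrality recovers the loss due to rounding: the floors of two reals at distance at most 1
    differ by less than 2, hence by at most 1, so that close pairs are rounded to close pairs of the
    same level. *)
Lemma natr_dist_le1 (a b : nat) : a%:R - b%:R < 2 :> R -> a%:R - b%:R <= 1 :> R.
Proof.
move=> h; rewrite lerBlDr nat1r ler_nat.
by rewrite ltrBlDr -natrD ltr_nat in h; lia.
Qed.

Lemma dyclose_dyfloor m s t : cube s -> cube t -> dyclose m s t ->
  dyclose m (dyfloor m s) (dyfloor m t).
Proof.
move=> cs ct /forallP st; apply/forallP => i; rewrite !mxE.
rewrite -mulrBl normrM [`|_^-1|]gtr0_norm ?invr_gt0 // -[leRHS]mul1r.
rewrite ler_wpM2r ?inv_exp2_ge0 //.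
have /andP[s0 s1] := cs i; have /andP[t0 t1] := ct i.
have s0' : 0 <= s ord0 i * 2 ^+ m by rewrite mulr_ge0 // ltW.
have t0' : 0 <= t ord0 i * 2 ^+ m by rewrite mulr_ge0 // ltW.
have [h1 h2] := truncn_bounds s0'.
have [h3 h4] := truncn_bounds t0'.
have : `|s ord0 i * 2 ^+ m - t ord0 i * 2 ^+ m| <= 1.
  rewrite -mulrBl normrM (gtr0_norm (exp2_gt0 m)).
  rewrite -[leRHS](@mulVf _ (2 ^+ m)) //.
  by rewrite ler_wpM2r // ltW.
rewrite !ler_norml => /andP[h5 h6]; apply/andP; split; last first.
  by apply: natr_dist_le1; lra.
by rewrite lerNl opprB; apply: natr_dist_le1; lra.
Qed.

Lemma dyfloor_close_succ m t : cube t ->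
  dyclose m.+1 (dyfloor m t) (dyfloor m.+1 t).
Proof.
move=> ct; apply/forallP => i; rewrite !mxE.
have /andP[t0 t1] := ct i.
have t0' : 0 <= t ord0 i * 2 ^+ m by rewrite mulr_ge0 // ltW.
have t1' : 0 <= t ord0 i * 2 ^+ m.+1 by rewrite mulr_ge0 // ltW.
have [h1 h2] := truncn_bounds t0'.
have [h3 h4] := truncn_bounds t1'.
have -> : (Num.truncn (t ord0 i * 2 ^+ m))%:R / 2 ^+ m =
   (2 * Num.truncn (t ord0 i * 2 ^+ m))%:R / 2 ^+ m.+1 :> R.
  by rewrite natrM exprS invfM mulrACA divff // mul1r.
rewrite -mulrBl normrM [`|_^-1|]gtr0_norm ?invr_gt0 // -[leRHS]mul1r.
rewrite ler_wpM2r ?inv_exp2_ge0 //.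
rewrite exprS mulrCA in h3 h4 *.
rewrite ler_norml; apply/andP; split; last first.
  by apply: natr_dist_le1; rewrite natrM; lra.
by rewrite lerNl opprB; apply: natr_dist_le1; rewrite natrM; lra.
Qed.

End dyadic.

(** * Chaining along dyadic roundings *)

Section chaining.
Context {R : realType} {n : nat}.
Implicit Types (m k : nat) (s t u v : 'rV[R]_n) (f : 'rV[R]_n -> R).

Definition grid_modulus f (B r : R) : Prop :=
  forall m u v, dyadic m u -> dyadic m v -> dyclose m u v ->
    `|f u - f v| <= B * r ^+ m.

Lemma grid_modulus_dyfloor f B r k m t : 0 < r < 1 -> 0 <= B ->
  grid_modulus f B r -> cube t -> (k <= m)%N ->
  `|f (dyfloor k t) - f (dyfloor m t)| <= B / (1 - r) * r ^+ k.
Proof.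
move=> /andP[r0 r1] B0 fB ct km.
have d0 : 0 < 1 - r by lra.
(* The difference of powers carries the induction: one more level adds [B * r ^+ m] to this bound,
   which dominates the new increment [B * r ^+ m.+1]. *)
suff : `|f (dyfloor k t) - f (dyfloor m t)| <= B / (1 - r) * (r ^+ k - r ^+ m).
  move=> /le_trans; apply; rewrite ler_wpM2l ?divr_ge0 ?(ltW d0) //.
  by rewrite gerBl exprn_ge0 // ltW.
elim: m km => [|m IHm].
  by rewrite leqn0 => /eqP ->; rewrite !subrr normr0 mulr0.
rewrite leq_eqVlt => /predU1P[->|]; first by rewrite !subrr normr0 mulr0.
rewrite ltnS => /IHm {}IHm.
have st : `|f (dyfloor m t) - f (dyfloor m.+1 t)| <= B * r ^+ m.+1.
  apply: fB; last exact: dyfloor_close_succ.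
    by apply: (@dyadic_le _ _ m) => //; exact: dyfloor_dyadic.
  exact: dyfloor_dyadic.
have := ler_distD (f (dyfloor m t)) (f (dyfloor k t)) (f (dyfloor m.+1 t)).
move=> /le_trans; apply; apply: (le_trans (lerD IHm st)).
have e : B / (1 - r) * (r ^+ k - r ^+ m.+1) =
    B / (1 - r) * (r ^+ k - r ^+ m) + B * r ^+ m.
  by rewrite exprS; field; rewrite gt_eqF.
rewrite e lerD2l ler_wpM2l // exprS ler_piMl ?exprn_ge0 //; exact: ltW.
Qed.

(** The 3 counts the two chains from level [m] up to level [k], one for each point, and the link
    between the two roundings at level [k], which are still close. *)
Lemma grid_modulus_close f B r k m s t : 0 < r < 1 -> 0 <= B ->
  grid_modulus f B r -> cube s -> cube t -> dyclose k s t -> (k <= m)%N ->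
  `|f (dyfloor m s) - f (dyfloor m t)| <= 3 / (1 - r) * B * r ^+ k.
Proof.
move=> r01 B0 fB cs ct st km; have /andP[r0 r1] := r01.
have d0 : 0 < 1 - r by lra.
have h1 := grid_modulus_dyfloor r01 B0 fB cs km.
have h2 := grid_modulus_dyfloor r01 B0 fB ct km.
have h3 : `|f (dyfloor k s) - f (dyfloor k t)| <= B / (1 - r) * r ^+ k.
  apply: (le_trans (fB k _ _ _ _ _)).
  - exact: dyfloor_dyadic.
  - exact: dyfloor_dyadic.
  - exact: dyclose_dyfloor.
  - rewrite ler_wpM2r ?exprn_ge0 ?(ltW r0) //.
    by rewrite ler_peMr // invf_ge1 //; lra.
have := ler_distD (f (dyfloor k s)) (f (dyfloor m s)) (f (dyfloor m t)).
move=> /le_trans; apply.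
have := ler_distD (f (dyfloor k t)) (f (dyfloor k s)) (f (dyfloor m t)).
move=> h4; apply: (le_trans (lerD (lexx _) h4)).
rewrite [X in X + _]distrC.
apply: (le_trans (lerD h1 (lerD h3 h2))).
by rewrite le_eqVlt; apply/orP; left; apply/eqP; ring.
Qed.

Lemma grid_modulus_dyadic f B r k m s t : 0 < r < 1 -> 0 <= B ->
  grid_modulus f B r -> dyadic m s -> dyadic m t -> dyclose k s t ->
  `|f s - f t| <= 3 / (1 - r) * B * r ^+ k.
Proof.
move=> r01 B0 fB ds dt st.
have ds' := dyadic_le (leq_maxl m k) ds.
have dt' := dyadic_le (leq_maxl m k) dt.
rewrite -(dyadic_dyfloor ds') -(dyadic_dyfloor dt').
apply: grid_modulus_close => //; last exact: leq_maxr.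
  exact: dyadic_cube ds.
exact: dyadic_cube dt.
Qed.

Lemma le_enorm (v : 'rV[R]_n) i : `|v ord0 i| <= enorm v.
Proof.
rewrite /enorm -sqrtr_sqr ler_wsqrtr // (bigD1 i) //= lerDl.
by apply: sumr_ge0 => j _; exact: sqr_ge0.
Qed.

Lemma enorm_ge0 (v : 'rV[R]_n) : 0 <= enorm v.
Proof. exact: sqrtr_ge0. Qed.

Lemma enorm_le (v : 'rV[R]_n) a : 0 <= a -> (forall i, `|v ord0 i| <= a) ->
  enorm v <= n%:R * a.
Proof.
move=> a0 va; rewrite /enorm -(ger0_norm (_ : 0 <= n%:R * a)) ?mulr_ge0 //.
rewrite -sqrtr_sqr ler_wsqrtr // exprMn.
apply: (@le_trans _ _ (\sum_(i < n) a ^+ 2)).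
  apply: ler_sum => i _; rewrite -[leLHS]real_normK ?num_real //.
  by rewrite lerXn2r // nnegrE.
rewrite sumr_const card_ord -[leLHS]mulr_natl ler_wpM2r ?sqr_ge0 //.
by rewrite -natrX ler_nat; case: n => // k; rewrite leq_pmulr.
Qed.

Lemma enorm_gt0 s t : s <> t -> 0 < enorm (t - s).
Proof.
move=> st; rewrite lt_neqAle enorm_ge0 andbT; apply/eqP => e.
apply: st; apply/rowP => i; have := le_enorm (t - s) i.
by rewrite -e normr_le0 !mxE subr_eq0 => /eqP.
Qed.

Lemma enorm_cube s t : cube s -> cube t -> enorm (t - s) <= n%:R.
Proof.
move=> cs ct; rewrite -[leRHS]mulr1; apply: enorm_le => // i.
by rewrite !mxE ler_norml; have := cs i; have := ct i; lra.
Qed.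

Lemma dyclose_enorm k s t : dyclose k s t -> enorm (t - s) <= n%:R * (2 ^+ k)^-1.
Proof.
move=> /forallP st; apply: enorm_le; first exact: inv_exp2_ge0.
by move=> i; rewrite !mxE distrC.
Qed.

Lemma Ndyclose_enorm k s t : ~~ dyclose k s t -> (2 ^+ k)^-1 < enorm (t - s).
Proof.
move=> /forallPn[i]; rewrite -ltNge => /lt_le_trans; apply.
by have := le_enorm (t - s) i; rewrite !mxE distrC.
Qed.

(** Level 0 accepts every pair of the cube and distinct points separate at some level, so the first
    separation happens at a successor. The level just before it places the sup distance between
    2^-(k+1) and 2^-k. *)
Lemma dyclose_scale s t : cube s -> cube t -> s <> t ->
  exists k, dyclose k s t /\ ~~ dyclose k.+1 s t.
Proof.
move=> cs ct st; have e0 := enorm_gt0 st.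
have [k0 hk0] : exists k, ~~ dyclose k s t.
  apply: contrapT => /forallNP h.
  have {}h k : dyclose k s t by have /negP := h k; rewrite negbK.
  apply: st; apply/rowP => i; apply/eqP; rewrite -subr_eq0 -normr_le0.
  rewrite leNgt; apply/negP => p0.
  have [m hm] : exists m, (2 ^+ m)^-1 < `|s ord0 i - t ord0 i|.
    exists (Num.truncn (`|s ord0 i - t ord0 i|^-1)).
    rewrite invf_plt ?posrE ?exp2_gt0 //.
    apply: lt_le_trans (truncnS_gt _) _.
    by rewrite -natrX ler_nat ltn_expl.
  by have /forallP/(_ i) := h m; rewrite leNgt hm.
have ex : exists k, ~~ dyclose k s t by exists k0.
have : (0 < ex_minn ex)%N.
  by case: ex_minnP => -[|m] //; rewrite dyclose0.
case: ex_minnP => -[|k] // hk hmin _; exists k; split.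
  by apply/negPn/negP => /hmin; rewrite ltnn.
exact: hk.
Qed.

End chaining.

(** * Moments of normalized dyadic increments *)

Section dyadic_energy.
Context {R : realType} {n : nat} {d : measure_display} {T : measurableType d}
  {P : probability T R}.
Implicit Types (X Y : 'rV[R]_n -> {RV P >-> R}) (p m : nat).

Definition close_pair m : pred (@grid_index n m * @grid_index n m) :=
  fun fg => dyclose m (grid_point fg.1 : 'rV[R]_n) (grid_point fg.2).

(** Its p-th root bounds every normalized increment, hence is a constant B of the grid modulus. A
    sum of p-th powers replaces the supremum because its expectation is a sum of moments. *)
Definition dyadic_energy X (r : R) p (w : T) : \bar R :=
  (\sum_(0 <= m <oo) \sum_(fg | close_pair (m := m) fg)
    ((`|X (grid_point fg.1) w - X (grid_point fg.2) w| / r ^+ m) ^+ p)%:E)%E.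

Lemma measurable_increment_pow X s t p :
  measurable_fun setT (fun w => (`|X s w - X t w| ^+ p)%:E).
Proof.
apply/measurable_EFinP/measurable_funX.
by apply/measurableT_comp => //; exact: measurable_funB.
Qed.

Lemma measurable_increment X s t p (c : R) :
  measurable_fun setT (fun w => ((`|X s w - X t w| / c) ^+ p)%:E).
Proof.
apply/measurable_EFinP/measurable_funX/measurable_funM => //.
by apply/measurableT_comp => //; exact: measurable_funB.
Qed.

Lemma dyadic_energy_term_ge0 X (r : R) p m w : 0 < r ->
  (0 <= \sum_(fg | close_pair (m := m) fg)
    ((`|X (grid_point fg.1) w - X (grid_point fg.2) w| / r ^+ m) ^+ p)%:E)%E.
Proof.
move=> r0; apply: sume_ge0 => fg _; rewrite lee_fin exprn_ge0 // divr_ge0 //.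
by rewrite exprn_ge0 // ltW.
Qed.

Lemma measurable_dyadic_energy_term X (r : R) p m :
  measurable_fun setT (fun w => \sum_(fg | close_pair (m := m) fg)
    ((`|X (grid_point fg.1) w - X (grid_point fg.2) w| / r ^+ m) ^+ p)%:E)%E.
Proof.
under eq_fun do rewrite -big_filter.
by apply: emeasurable_sum => fg; exact: measurable_increment.
Qed.

Lemma dyadic_energy_ge0 X (r : R) p w : 0 < r -> (0 <= dyadic_energy X r p w)%E.
Proof. by move=> r0; apply: nneseries_ge0 => m _ _; exact: dyadic_energy_term_ge0. Qed.

Lemma measurable_dyadic_energy X (r : R) p : 0 < r ->
  measurable_fun setT (dyadic_energy X r p).
Proof.
move=> r0; apply: ge0_emeasurable_sum => [m w _ _|m _].
  exact: dyadic_energy_term_ge0.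
exact: measurable_dyadic_energy_term.
Qed.

Lemma dyadic_energy_modulus X (r B : R) p w : 0 < r -> 0 <= B -> (0 < p)%N ->
  (dyadic_energy X r p w <= (B ^+ p)%:E)%E ->
  grid_modulus (fun t => X t w) B r.
Proof.
move=> r0 B0 p0 WB m u v [f ->] [g ->] fg.
have rm0 : 0 < r ^+ m by exact: exprn_gt0.
rewrite -ler_pdivrMr // -(ler_pXn2r p0) ?nnegrE ?divr_ge0 ?(ltW rm0) //.
rewrite -lee_fin; apply: le_trans WB.
have h0 k := dyadic_energy_term_ge0 X p k w r0.
rewrite /dyadic_energy (@nneseriesD1 _ _ m) //.
apply: le_trans (leeDl _ _); last first.
  by apply: nneseries_ge0 => *; exact: h0.
rewrite (bigD1 (f, g)) //=; apply: leeDl.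
apply: sume_ge0 => fg' _; rewrite lee_fin exprn_ge0 // divr_ge0 //.
exact: ltW.
Qed.

(** All pairs are counted, not only the close ones: the growth rate 4^n in the level is wasteful,
    but it is paid for by a larger p. *)
Lemma card_close_pair m :
  (#|@close_pair m|%:R <= 4 ^+ n * (4 ^+ n) ^+ m :> R)%R.
Proof.
have le2 : ((2 ^ m).+1 ^ n * (2 ^ m).+1 ^ n <= 4 ^ n * (4 ^ n) ^ m)%N.
  rewrite -expnMn -expnM -expnD -mulnS (mulnC n m.+1) expnM.
  have -> : (4 ^ m.+1 = 2 ^ m.+1 * 2 ^ m.+1)%N by rewrite -expnMn.
  case: n => // k; rewrite leq_exp2r //.
  by apply: leq_mul; rewrite expnS mul2n -addnn -addn1 leq_add2l expn_gt0.
have : (#|@close_pair m| <= (2 ^ m).+1 ^ n * (2 ^ m).+1 ^ n)%N.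
  apply: (leq_trans (max_card _)).
  by rewrite card_prod card_ffun !card_ord.
move=> /leq_trans/(_ le2); rewrite -(ler_nat R) => /le_trans; apply.
by rewrite natrM !natrX.
Qed.

Lemma nneseries_le (u : nat -> \bar R) (b : \bar R) : (forall m, 0 <= u m)%E ->
  (forall N, \sum_(0 <= m < N) u m <= b)%E -> (\sum_(0 <= m <oo) u m <= b)%E.
Proof.
move=> u0 ub; apply: lime_le; first exact: is_cvg_ereal_nneg_natsum.
by near=> N; exact: ub.
Unshelve. all: by end_near. Qed.

(* The number of close pairs of level m is at most 4^n (4^n)^m, so the hypothesis
   on q / r makes the sum over m a geometric series of ratio 1/2. *)
Lemma integral_dyadic_energy X (A q r : R) p : 0 < r -> 0 <= q -> 0 <= A ->
  (q / r) ^+ p <= (2 * 4 ^+ n)^-1 ->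
  (forall m u v, dyadic m u -> dyadic m v -> dyclose m u v ->
    (\int[P]_w (`|X u w - X v w| ^+ p)%:E <= ((A * q ^+ m) ^+ p)%:E)%E) ->
  (\int[P]_w dyadic_energy X r p w <= (2 * 4 ^+ n * A ^+ p)%:E)%E.
Proof.
move=> r0 q0 A0 qr mX.
have c0 : 0 <= 4 ^+ n * A ^+ p by rewrite mulr_ge0 ?exprn_ge0.
rewrite /dyadic_energy integral_nneseries //; first last.
- by move=> m w _; exact: dyadic_energy_term_ge0.
- by move=> m; exact: measurable_dyadic_energy_term.
apply: nneseries_le => [m|N].
  by apply: integral_ge0 => w _; exact: dyadic_energy_term_ge0.
apply: (@le_trans _ _ (\sum_(0 <= m < N) (4 ^+ n * A ^+ p * 2^-1 ^+ m)%:E)%E).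
  apply: lee_sum => m _.
  have rm0 : 0 < r ^+ m by exact: exprn_gt0.
  under eq_integral do rewrite big_mkcond.
  rewrite (@ge0_integral_sum _ _ _ P _ measurableT _ (fun fg w => if close_pair fg then
    ((`|X (grid_point fg.1) w - X (grid_point fg.2) w| / r ^+ m) ^+ p)%:E
    else 0%E)) //; first last.
  - move=> fg w _; case: ifP => // _.
    by rewrite lee_fin exprn_ge0 // divr_ge0 // ltW.
  - by move=> fg; case: close_pair => //; exact: measurable_increment.
  apply: (@le_trans _ _ (\sum_(fg | close_pair (m := m) fg)
       ((A * (q / r) ^+ m) ^+ p)%:E)%E).
    rewrite [leRHS]big_mkcond; apply: lee_sum => fg _.
    case: ifPn => [cfg|_]; last by rewrite integral0.
    under eq_integral do rewrite expr_div_n mulrC EFinM.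
    rewrite ge0_integralZl//; first last.
    - by rewrite lee_fin invr_ge0 !exprn_ge0 // ltW.
    - exact: measurable_increment_pow.
    have {}mX := mX m _ _ (ex_intro _ fg.1 erefl) (ex_intro _ fg.2 erefl) cfg.
    apply: (@le_trans _ _ (((r ^+ m) ^+ p)^-1%:E * ((A * q ^+ m) ^+ p)%:E)%E).
      by apply: lee_wpmul2l => //; rewrite lee_fin invr_ge0 !exprn_ge0 // ltW.
    by rewrite -EFinM lee_fin mulrC -exprVn -exprMn -mulrA -exprVn -exprMn.
  rewrite sumEFin lee_fin sumr_const -[leLHS]mulr_natl.
  apply: (@le_trans _ _ (4 ^+ n * (4 ^+ n) ^+ m * (A * (q / r) ^+ m) ^+ p)).
    rewrite ler_wpM2r ?card_close_pair // exprn_ge0 // mulr_ge0 // exprn_ge0 //.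
    by rewrite divr_ge0 // ltW.
  rewrite [(A * _) ^+ p]exprMn mulrACA ler_wpM2l // [((q / r) ^+ m) ^+ p]exprAC -exprMn.
  rewrite lerXn2r ?nnegrE //.
  - by rewrite mulr_ge0 ?exprn_ge0 // divr_ge0 // ltW.
  - apply: (le_trans (ler_wpM2l _ qr)); first by rewrite exprn_ge0.
    by rewrite invfM mulrCA divff ?mulr1 // expf_neq0.
rewrite sumEFin lee_fin.
have -> : 2 * 4 ^+ n * A ^+ p = 4 ^+ n * A ^+ p / (1 - 2^-1).
  by field.
apply: geometric_le_lim => //; rewrite ger0_norm; lra.
Qed.

End dyadic_energy.

(** * Invariance under modification, and moments of increments *)

Section moments.
Context {R : realType} {n : nat} {d : measure_display} {T : measurableType d}
  {P : probability T R}.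
Implicit Types (X Y : 'rV[R]_n -> {RV P >-> R}).

Lemma measurable_RV_eq (Z Z' : {RV P >-> R}) : measurable [set w | Z w = Z' w].
Proof.
have := @measurable_fun_eqr _ _ _ setT _ _ (measurable_funPT Z)
  (measurable_funPT Z') measurableT [set true] I.
by rewrite setTI; congr measurable; apply/seteqP; split => w /= /eqP.
Qed.

Lemma modification_ae X Y t : modification X Y -> cube t ->
  {ae P, forall w, Y t w = X t w}.
Proof.
move=> XY ct; set E := [set w | Y t w = X t w].
have mE : measurable E by exact: measurable_RV_eq.
exists (~` E); split => //; first exact: measurableC.
by rewrite probability_setC // XY // subee.
Qed.

Lemma modification_increment_ae X Y s t : modification X Y -> cube s -> cube t ->
  {ae P, forall w, Y t w - Y s w = X t w - X s w}.
Proof.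
move=> XY cs ct; have := modification_ae XY cs; have := modification_ae XY ct.
by apply: filterS2 => w -> ->.
Qed.

Lemma modification_expectation X Y s t (g : R -> R) : modification X Y ->
  cube s -> cube t -> measurable_fun setT g -> (forall x, 0 <= g x) ->
  ('E_P[fun w => g (Y t w - Y s w)%R] = 'E_P[fun w => g (X t w - X s w)%R])%E.
Proof.
move=> XY cs ct mg g0; rewrite unlock; apply: ge0_ae_eq_integral => //.
- apply/measurable_EFinP/measurableT_comp => //; exact: measurable_funB.
- apply/measurable_EFinP/measurableT_comp => //; exact: measurable_funB.
- by move=> w _; rewrite lee_fin.
- by move=> w _; rewrite lee_fin.
have := modification_increment_ae XY cs ct.
by apply: filterS => w + _ => ->.
Qed.

Lemma modification_increments_L2 X Y : modification X Y ->
  increments_L2 X -> increments_L2 Y.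
Proof.
move=> XY X2 s t cs ct.
rewrite (modification_expectation (g := fun x => `|x| ^+ 2) XY cs ct).
- exact: X2.
- by apply: measurable_funX; exact: normr_measurable.
- by move=> x; exact: exprn_ge0.
Qed.

Lemma modification_hypercontractive X Y C0 iota : modification X Y ->
  hypercontractive X C0 iota -> hypercontractive Y C0 iota.
Proof.
move=> XY X2 p s t p1 cs ct.
rewrite (modification_expectation (g := fun x => `|x| ^+ 2) XY cs ct).
- rewrite (modification_expectation (g := fun x => `|x| `^ p) XY cs ct).
  + exact: X2.
  + apply: (@measurableT_comp _ _ _ _ _ _ (fun y : R => y `^ p) _ (fun x : R => `|x|)).
      exact: measurable_powR.
    exact: normr_measurable.
  + by move=> x; exact: powR_ge0.
- by apply: measurable_funX; exact: normr_measurable.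
- by move=> x; exact: exprn_ge0.
Qed.

Lemma modification_variance_bound X Y alpha eps K : modification X Y ->
  variance_bound X alpha eps K -> variance_bound Y alpha eps K.
Proof.
move=> XY X2 s t cs ct st.
rewrite (modification_expectation (g := fun x => x ^+ 2) XY cs ct).
- exact: X2.
- exact: measurable_funX.
- by move=> x; exact: sqr_ge0.
Qed.

Lemma moment_le X C0 iota v (p : nat) s t : 0 < C0 -> hypercontractive X C0 iota ->
  cube s -> cube t -> (0 < p)%N -> 0 <= v ->
  ('E_P[fun w => ((X t w - X s w) ^+ 2)%R] <= v%:E)%E ->
  (\int[P]_w (`|X t w - X s w| ^+ p)%:E <=
    ((C0 * p%:R `^ iota * v `^ 2^-1) ^+ p)%:E)%E.
Proof.
move=> C00 hX cs ct p0 v0 Xv.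
have p1 : 1 <= p%:R :> R by rewrite ler1n.
have e2 : ('E_P[fun w => (`|X t w - X s w| ^+ 2)%R] =
           'E_P[fun w => ((X t w - X s w) ^+ 2)%R])%E.
  by congr expectation; apply/funext => w; rewrite real_normK ?num_real.
have := hX p%:R s t p1 cs ct; rewrite e2.
have -> : ('E_P[fun w => (`|X t w - X s w| `^ p%:R)%R] =
   \int[P]_w (`|X t w - X s w| ^+ p)%:E)%E.
  by rewrite unlock; apply: eq_integral => w _; rewrite powR_mulrn.
move=> /le_trans; apply.
apply: (@le_trans _ _ ((C0 `^ p%:R * p%:R `^ (p%:R * iota))%:E *
   v%:E `^ (p%:R / 2))%E).
  apply: lee_wpmul2l; first by rewrite lee_fin mulr_ge0 ?powR_ge0.
  apply: gt0_ler_poweR => //.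
  - rewrite in_itv /= leey andbT; apply: expectation_ge0 => w.
    exact: sqr_ge0.
  - by rewrite in_itv /= leey andbT lee_fin.
have powM (x y : R) : x `^ (p%:R * y) = (x `^ y) ^+ p.
  by rewrite mulrC powRrM powR_mulrn // powR_ge0.
by rewrite poweR_EFin -EFinM lee_fin !exprMn !powM powR_mulrn // ltW.
Qed.

End moments.

(** * From almost sure continuity to the variance bound *)

Section holder_variance.
Context {R : realType} {n : nat} {d : measure_display} {T : measurableType d}
  {P : probability T R}.
Implicit Types (X Y : 'rV[R]_n -> {RV P >-> R}).

Lemma probability_integral_cst (c : \bar R) : (\int[P]_w c = c)%E.
Proof.
transitivity (c * P setT)%E; first exact: integral_cst.
by rewrite probability_setT mule1.
Qed.

Lemma measurable_gt (C : {RV P >-> \bar R}) (M : R) :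
  measurable [set w | (M%:E < C w)%E].
Proof.
have := measurable_funPT C measurableT _ (emeasurable_itv `]M%:E, +oo[).
rewrite setTI; congr measurable.
by apply/seteqP; split => w /=; rewrite in_itv /= andbT.
Qed.

(** The events C > k decrease to a null event as k grows, so continuity of P from above makes their
    probabilities vanish. *)
Lemma fin_num_tail (C : {RV P >-> \bar R}) (delta : R) :
  {ae P, forall w, C w \is a fin_num} -> 0 < delta ->
  exists M : R, 0 < M /\ (P [set w | (M%:E < C w)%E] <= delta%:E)%E.
Proof.
move=> Cfin d0; pose F k := [set w | (k%:R%:E < C w)%E] : set T.
have mF k : measurable (F k) by exact: measurable_gt.
have mI : measurable (\bigcap_k F k) by exact: bigcap_measurable.
have PI : P (\bigcap_k F k) = 0%E.
  apply/(negligibleP _ mI); apply: negligibleS Cfin => w Fw /= Cw.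
  have := Fw (Num.truncn (fine (C w))).+1 I.
  by rewrite /F /= -(fineK Cw) lte_fin ltNge (ltW (truncnS_gt _)).
have : (P \o F) k @[k --> \oo] --> (0 : \bar R)%E.
  rewrite -PI; apply: nonincreasing_cvg_mu => //; first by rewrite -ge0_fin_numE ?fin_num_measure.
  move=> k m km; apply/subsetPset => w; apply: le_lt_trans.
  by rewrite lee_fin ler_nat.
move=> /(_ [set x | (x < delta%:E)%E]) [].
  by apply: open_ereal_lt'; rewrite lte_fin.
move=> k _ /(_ k) /= Fk; exists k.+1%:R; split => //.
apply: (@le_trans _ _ (P (F k))); last by apply: ltW; apply: Fk.
apply: le_measure; rewrite ?inE //; first exact: measurable_gt.
by move=> w /=; apply: le_lt_trans; rewrite lee_fin ler_nat.
Qed.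

Lemma holder_variance_bound X Y (C0 iota alpha : R) : 0 < C0 ->
  increments_L2 X -> hypercontractive X C0 iota ->
  modification X Y -> holder_below Y alpha ->
  forall eps : R, 0 < eps -> exists K : R, 0 < K /\ variance_bound X alpha eps K.
Proof.
move=> C00 X2 hX XY hY eps eps0.
have [C [Cfin CY]] := hY (eps / 2) (divr_gt0 eps0 (ltr0n _ 2)).
(* The constant of the fourth moment against the squared variance. It is the same for all pairs, so
   the truncation level [M] can be fixed before [s] and [t]. *)
pose L := (C0 * 4 `^ iota) ^+ 4.
have L0 : 0 < L by rewrite exprn_gt0 // mulr_gt0 // powR_gt0.
have [|M [M0 PM]] := @fin_num_tail C (4 * L)^-1 Cfin.
  by rewrite invr_gt0 mulr_gt0.
exists (2 * M ^+ 2); split; first by rewrite mulr_gt0 // exprn_gt0.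
move=> s t cs ct st.
have h0 : 0 < enorm (t - s) by exact: enorm_gt0.
set h := enorm (t - s) in h0 *; pose g := h `^ (alpha - eps / 2).
have g0 : 0 < g by exact: powR_gt0.
have -> : h `^ (2 * alpha - eps) = g ^+ 2.
  by rewrite /g -powR_mulrn ?powR_ge0 // -powRrM; congr (_ `^ _); field.
have EX2 : ('E_P[fun w => ((X t w - X s w) ^+ 2)%R] \is a fin_num)%E.
  rewrite ge0_fin_numE; last by apply: expectation_ge0 => w; exact: sqr_ge0.
  apply: le_lt_trans (X2 s t cs ct); rewrite unlock le_eqVlt; apply/orP; left.
  by apply/eqP; apply: eq_integral => w _; rewrite real_normK ?num_real.
rewrite -(fineK EX2) lee_fin; set v := fine _.
have vE : v%:E = 'E_P[fun w => ((X t w - X s w) ^+ 2)%R]%E by rewrite fineK.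
have [v0|v0] := leP v 0.
  by apply: (le_trans v0); rewrite -mulrA -exprMn mulr_ge0 ?sqr_ge0.
have X4 : (\int[P]_w (`|X t w - X s w| ^+ 4)%:E <= (L * v ^+ 2)%:E)%E.
  apply: (le_trans (moment_le C00 hX cs ct _ (ltW v0) _)) => //.
    by rewrite -vE.
  rewrite lee_fin /L exprMn (_ : v `^ 2^-1 ^+ 4 = v ^+ 2) //.
  by rewrite (exprM _ 2 2) -[X in X ^+ 2]powR_mulrn ?powR_ge0 // -powRrM mulVf // powRr1 // ltW.
(* With this [l] the fourth-moment term and the tail term are both at most v/4. Together they leave
   half of [v] on the left, whence the 2 in [2 * M ^+ 2]. *)
pose l := 2 * L * v.
have l0 : 0 < l by rewrite !mulr_gt0.
set A := [set w | (M%:E < C w)%E] in PM.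
have mA : measurable A by exact: measurable_gt.
have m4 : measurable_fun setT (fun w => ((l^-1 / 2)%:E * (`|X t w - X s w| ^+ 4)%:E)%E).
  by apply: emeasurable_funM => //; exact: measurable_increment_pow.
have mA' : measurable_fun setT (fun w => ((l / 2)%:E * (\1_A w)%:E)%E).
  by apply: emeasurable_funM => //; exact/measurable_EFinP/measurable_indic.
have p4 w : setT w -> (0 <= (l^-1 / 2)%:E * (`|X t w - X s w| ^+ 4)%:E)%E.
  by rewrite -EFinM lee_fin !mulr_ge0 ?exprn_ge0 // invr_ge0 ltW.
have pA w : setT w -> (0 <= (l / 2)%:E * (\1_A w)%:E)%E.
  by rewrite -EFinM lee_fin !mulr_ge0 // ltW.
have mrhs := emeasurable_funD m4 mA'.
have prhs w (_ : setT w) := adde_ge0 (p4 w I) (pA w I).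
(* Off A the increment is at most M g; on A use D^2 <= D^4 / (2 l) + l / 2. *)
have key : (v%:E <= \int[P]_w ((M ^+ 2 * g ^+ 2)%:E +
   ((l^-1 / 2)%:E * (`|X t w - X s w| ^+ 4)%:E + (l / 2)%:E * (\1_A w)%:E)))%E.
  rewrite vE unlock; apply: ae_ge0_le_integral => //.
  - by move=> w _; rewrite lee_fin sqr_ge0.
  - by apply/measurable_EFinP/measurable_funX; exact: measurable_funB.
  - by move=> w _; apply: adde_ge0; [rewrite lee_fin mulr_ge0 ?sqr_ge0|exact: prhs].
  - by apply: emeasurable_funD => //; exact: mrhs.
  have := modification_increment_ae XY cs ct; move: CY; apply: filterS2.
  move=> w /(_ s t cs ct st) CYw YXw _; rewrite -!EFinM -!EFinD lee_fin.
  rewrite -YXw; set D := Y t w - Y s w in CYw *.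
  have -> : `|D| ^+ 4 = (D ^+ 2) ^+ 2.
    by rewrite -[D ^+ 2]real_normK ?num_real // -exprM.
  have DD : D ^+ 2 <= l^-1 / 2 * (D ^+ 2) ^+ 2 + l / 2.
    have -> : l^-1 / 2 * (D ^+ 2) ^+ 2 + l / 2 =
        D ^+ 2 + (D ^+ 2 - l) ^+ 2 / (2 * l) by field; rewrite gt_eqF.
    by rewrite lerDl divr_ge0 ?sqr_ge0 // mulr_ge0 // ltW.
  rewrite indicE; have [wA|wA] := boolP (w \in A).
    rewrite mulr1; apply: (le_trans DD); rewrite lerDr mulr_ge0 ?sqr_ge0 //.
  rewrite mulr0 addr0; apply: (@le_trans _ _ (M ^+ 2 * g ^+ 2)).
    rewrite -exprMn -[leLHS]real_normK ?num_real // lerXn2r // ?nnegrE //.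
      by rewrite mulr_ge0 // ltW.
    move: wA; rewrite notin_setE /A /= => /negP; rewrite -leNgt => CM.
    rewrite -lee_fin; apply: (le_trans CYw); rewrite EFinM.
    by apply: lee_wpmul2r => //; rewrite lee_fin ltW.
  by rewrite lerDl mulr_ge0 ?sqr_ge0 // divr_ge0 // invr_ge0 ltW.
have {key} : (v%:E <= (M ^+ 2 * g ^+ 2)%:E +
   ((l^-1 / 2 * (L * v ^+ 2))%:E + (l / 2 * (4 * L)^-1)%:E))%E.
  apply: (le_trans key); rewrite ge0_integralD //; last first.
    by move=> w _; rewrite lee_fin mulr_ge0 ?sqr_ge0.
  rewrite probability_integral_cst leeD2l //.
  rewrite ge0_integralD // !ge0_integralZl //; first last.
  - by rewrite lee_fin mulr_ge0 ?invr_ge0 // ltW.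
  - exact: measurable_increment_pow.
  - by rewrite lee_fin divr_ge0 // ltW.
  - exact/measurable_EFinP/measurable_indic.
  rewrite integral_indic // setIT (EFinM (_ / _) (L * _)) (EFinM (l / 2)).
  apply: leeD; apply: lee_wpmul2l => //; rewrite lee_fin.
    by rewrite mulr_ge0 ?invr_ge0 // ltW.
  by rewrite divr_ge0 // ltW.
rewrite -!EFinD lee_fin /l.
have -> : (2 * L * v)^-1 / 2 * (L * v ^+ 2) = v / 4.
  by field; rewrite !gt_eqF.
have -> : 2 * L * v / 2 * (4 * L)^-1 = v / 4.
  by field; rewrite gt_eqF.
by rewrite -mulrA; lra.
Qed.

End holder_variance.

(** * Limits along dyadic roundings *)

Section dyadic_limits.
Context {R : realType} {n : nat}.
Implicit Types (m k : nat) (s t u v : 'rV[R]_n) (f : 'rV[R]_n -> R).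

Lemma exp2N_lt1 (g : R) : 0 < g -> 0 < 2 `^ (- g) < 1.
Proof.
move=> g0; rewrite powR_gt0 //= powRN invf_lt1 ?powR_gt0 //.
have := @gt0_ltr_powR _ g g0 1 2; rewrite powR1; apply; rewrite ?nnegrE //.
by rewrite ltr1n.
Qed.

Lemma exp2N_exp (g : R) k : (2 `^ (- g)) ^+ k = ((2 ^+ k)^-1) `^ g.
Proof.
have -> : (2 ^+ k)^-1 `^ g = ((2 ^+ k) `^ g)^-1.
  by rewrite -powR_inv1 ?exprn_ge0 // -powRrM mulN1r powRN.
rewrite -[2 ^+ k]powR_mulrn // -powRrM -powRN.
by rewrite -[LHS]powR_mulrn ?powR_ge0 // -powRrM mulNr mulrC.
Qed.

Lemma exp2N_scale (g h : R) k : 0 < g -> (2 ^+ k.+1)^-1 <= h ->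
  (2 `^ (- g)) ^+ k <= 2 `^ g * h `^ g.
Proof.
move=> g0 kh; rewrite exp2N_exp.
have h0 : 0 <= h by apply: le_trans kh; exact: inv_exp2_ge0.
rewrite -powRM //; apply: ge0_ler_powR => //; first exact: ltW.
- by rewrite nnegrE inv_exp2_ge0.
- by rewrite nnegrE mulr_ge0.
apply: le_trans (ler_wpM2l _ kh) => //.
by rewrite exprS invfM mulVKf.
Qed.

Lemma grid_modulus_cvg f (B r : R) t : 0 < r < 1 -> 0 <= B ->
  grid_modulus f B r -> cube t -> cvgn (fun m => f (dyfloor m t)).
Proof.
move=> r01 B0 fB ct; have /andP[r0 r1] := r01.
apply/cauchy_cvgP/cauchy_exP => e e0.
have /cvgrPdist_lt/(_ e e0) : (fun k => B / (1 - r) * r ^+ k) @ \oo --> (0 : R).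
  rewrite -[X in _ --> X](mulr0 (B / (1 - r))); apply: cvgMr.
  by apply: cvg_expr; rewrite ger0_norm // ltW.
move=> [k _ /(_ k (leqnn k))] /=; rewrite sub0r normrN => ke.
exists (f (dyfloor k t)); exists k => // m /= km.
rewrite /ball /=; apply: le_lt_trans ke.
exact: le_trans (grid_modulus_dyfloor r01 B0 fB ct km) (ler_norm _).
Qed.

(** The estimate concerns limits [a] and [b], not values of [f] at [s] and [t]: off the grid nothing
    is known of [f], and the modification will be defined by these limits. *)
Lemma grid_modulus_holder f (B g a b : R) s t : 0 < g -> 0 <= B ->
  grid_modulus f B (2 `^ (- g)) -> cube s -> cube t -> s <> t ->
  (fun m => f (dyfloor m s)) @ \oo --> a ->
  (fun m => f (dyfloor m t)) @ \oo --> b ->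
  `|b - a| <= 3 / (1 - 2 `^ (- g)) * 2 `^ g * B * enorm (t - s) `^ g.
Proof.
move=> g0 B0 fB cs ct st fa fb.
have r01 := exp2N_lt1 g0; have /andP[r0 r1] := r01.
have [k [kst hk]] := dyclose_scale cs ct st.
have d0 : 0 <= 3 / (1 - 2 `^ (- g)) * B.
  by rewrite mulr_ge0 // divr_ge0 // subr_ge0 ltW.
apply: (@le_trans _ _ (3 / (1 - 2 `^ (- g)) * B * (2 `^ (- g)) ^+ k)); last first.
  rewrite [3 / _ * _ * B]mulrAC -[leRHS]mulrA ler_wpM2l //.
  by apply: exp2N_scale => //; exact/ltW/Ndyclose_enorm.
have cv : (fun m => `|f (dyfloor m t) - f (dyfloor m s)|) @ \oo --> `|b - a|.
  by apply: cvg_norm; apply: cvgB.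
rewrite -(cvg_lim _ cv) //; apply: limr_le; first by apply/cvg_ex; exists `|b - a|.
near=> m; rewrite distrC; apply: grid_modulus_close => //.
by near: m; exists k.
Unshelve. all: by end_near. Qed.

End dyadic_limits.

(** * Moments and finiteness of the dyadic energy *)

Section kolmogorov.
Context {R : realType} {n : nat} {d : measure_display} {T : measurableType d}
  {P : probability T R}.
Implicit Types (X Y : 'rV[R]_n -> {RV P >-> R}).

Lemma measurable_RV {d'} {T' : measurableType d'} (f : T -> T') :
  measurable_fun setT f -> exists X : {RV P >-> T'}, forall w, X w = f w.
Proof.
move=> mf; pose X : {RV P >-> T'} := HB.pack f (isMeasurableFun.Build _ _ _ _ f mf).
by exists X.
Qed.

Lemma sqr_powR_half (x : R) : 0 <= x -> (x ^+ 2) `^ 2^-1 = x.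
Proof. by move=> x0; rewrite powR12_sqrt ?sqr_ge0 // sqrtr_sqr ger0_norm. Qed.

Lemma variance_dyclose X (alpha eps K a : R) m s t : 0 < K -> 0 < a ->
  a = alpha - eps / 2 -> variance_bound X alpha eps K -> cube s -> cube t ->
  dyclose m s t ->
  ('E_P[fun w => ((X t w - X s w) ^+ 2)%R] <=
    ((K `^ 2^-1 * n%:R `^ a * (2 `^ (- a)) ^+ m) ^+ 2)%:E)%E.
Proof.
move=> K0 a0 aE XK cs ct cst; have [->|/eqP st] := eqVneq s t.
  rewrite unlock; under eq_integral do rewrite subrr expr0n /=.
  by rewrite integral0 lee_fin sqr_ge0.
apply: (le_trans (XK s t cs ct st)); rewrite lee_fin.
have -> : 2 * alpha - eps = a * 2 by rewrite aE; field.
rewrite powRrM powR_mulrn ?powR_ge0 //.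
have -> : K * (enorm (t - s) `^ a) ^+ 2 = (K `^ 2^-1 * enorm (t - s) `^ a) ^+ 2.
  by rewrite exprMn powR12_sqrt ?(ltW K0) // sqr_sqrtr // ltW.
have h0 : 0 <= n%:R * (2 ^+ m)^-1 :> R by rewrite mulr_ge0 // inv_exp2_ge0.
rewrite lerXn2r ?nnegrE ?mulr_ge0 ?exprn_ge0 ?powR_ge0 // -mulrA.
rewrite ler_wpM2l ?powR_ge0 // exp2N_exp -powRM ?inv_exp2_ge0 //.
apply: ge0_ler_powR; rewrite ?nnegrE ?enorm_ge0 ?(ltW a0) //.
exact: dyclose_enorm.
Qed.

(** Level-m increments divided by r^m have size of order (q/r)^m with q/r = 2^-(a-g) < 1, so a large
    p beats the number of pairs. All p from [p0] on are covered, with [A] free of p, because the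
    exponential moment uses every large p. *)
Lemma dyadic_energy_moments X (C0 iota alpha eps K a g : R) :
  0 < C0 -> hypercontractive X C0 iota -> 0 < K -> variance_bound X alpha eps K ->
  a = alpha - eps / 2 -> 0 < g -> g < a ->
  exists A p0, [/\ 0 <= A, (0 < p0)%N & forall p, (p0 <= p)%N ->
    (\int[P]_w dyadic_energy X (2 `^ (- g)) p w <=
      (2 * 4 ^+ n * (A * p%:R `^ iota) ^+ p)%:E)%E].
Proof.
move=> C00 hX K0 XK aE g0 ga; have a0 : 0 < a by exact: lt_trans ga.
set r := 2 `^ (- g); set q := 2 `^ (- a).
have /andP[r0 r1] : 0 < r < 1 by exact: exp2N_lt1.
have /andP[q0 q1] : 0 < q < 1 by exact: exp2N_lt1.
have qr : 0 <= q / r < 1.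
  rewrite divr_ge0 ?ltW //= ltr_pdivrMr // mul1r /q /r.
  have := @exp2N_lt1 _ (a - g); rewrite subr_gt0 => /(_ ga)/andP[_].
  rewrite opprB => lt1; have -> : - a = (g - a) + (- g) by ring.
  by rewrite powRD ?pnatr_eq0 ?implybT // gtr_pMl // powR_gt0.
have /andP[qr0 qr1] := qr.
have c0 : 0 < (2 * 4 ^+ n)^-1 :> R by rewrite invr_gt0 mulr_gt0 // exprn_gt0.
have /cvgrPdist_lt/(_ _ c0) : (fun k => (q / r) ^+ k) @ \oo --> (0 : R).
  by apply: cvg_expr; rewrite ger0_norm.
move=> [p0 _ hp0].
pose s0 := K `^ 2^-1 * n%:R `^ a.
have s00 : 0 <= s0 by rewrite mulr_ge0 ?powR_ge0.
(* [p0] was chosen from n and the gap [a - g] alone; the successor keeps the exponents positive. *)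
exists (C0 * s0), p0.+1; split => // [|p pp]; first by rewrite mulr_ge0 // ltW.
apply: (@integral_dyadic_energy _ _ _ _ _ _ _ q) => //.
- exact: ltW.
- by rewrite !mulr_ge0 ?powR_ge0 // ltW.
- have := hp0 p (ltnW pp); rewrite /= sub0r normrN => /ltW; apply: le_trans.
  exact: ler_norm.
move=> m u v du dv cuv.
have cu := dyadic_cube du; have cv := dyadic_cube dv.
rewrite dyclose_sym in cuv.
have V := variance_dyclose K0 a0 aE XK cv cu cuv.
have := moment_le C00 hX cv cu (leq_trans (ltn0Sn _) pp) (sqr_ge0 _) V.
move=> /le_trans; apply; rewrite lee_fin sqr_powR_half ?mulr_ge0 ?exprn_ge0 ?powR_ge0 //.
by rewrite -/s0 -/q le_eqVlt; apply/orP; left; apply/eqP; congr (_ ^+ p); ring.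
Qed.

Lemma dyadic_energy_ae_fin X (r : R) p : 0 < r ->
  (\int[P]_w dyadic_energy X r p w < +oo)%E ->
  {ae P, forall w, (dyadic_energy X r p w < +oo)%E}.
Proof.
move=> r0 Wfin; have : P.-integrable setT (dyadic_energy X r p).
  apply/integrableP; split; first exact: measurable_dyadic_energy.
  by under eq_integral do rewrite gee0_abs ?dyadic_energy_ge0 //.
move=> /(integrable_ae measurableT); apply: filterS => w /(_ I).
by rewrite ge0_fin_numE ?dyadic_energy_ge0.
Qed.

(** Where only finiteness matters, 1 + W is simpler than the p-th root of W and serves as well,
    since W is at most (1 + W)^p. *)
Lemma dyadic_energy_fin_modulus X (r : R) p w : 0 < r -> (0 < p)%N ->
  (dyadic_energy X r p w < +oo)%E ->
  grid_modulus (fun t => X t w) (1 + fine (dyadic_energy X r p w)) r.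
Proof.
move=> r0 p0 Wfin; have W0 := dyadic_energy_ge0 X p w r0.
have Wf : (dyadic_energy X r p w \is a fin_num) by rewrite ge0_fin_numE.
have f0 : 0 <= fine (dyadic_energy X r p w) by exact: fine_ge0.
apply: (dyadic_energy_modulus r0 _ p0); first by rewrite addr_ge0.
rewrite -[leLHS](fineK Wf) lee_fin.
by apply: (@le_trans _ _ (1 + fine (dyadic_energy X r p w))); rewrite ?lerDr // ler_eXnr // lerDl.
Qed.

End kolmogorov.

(** * Identification of the limit with the original field *)

Section kolmogorov_modification.
Context {R : realType} {n : nat} {d : measure_display} {T : measurableType d}
  {P : probability T R}.
Implicit Types (X Y : 'rV[R]_n -> {RV P >-> R}).

(** The variance bound gives convergence of X at the roundings to [X t] in mean square; by Fatou,
    the almost sure limit [Z] then satisfies E (Z - X t)^2 = 0. *)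
Lemma dyfloor_limit_ae X (Z : {RV P >-> R}) (alpha eps K a : R) t :
  0 < K -> 0 < a -> a = alpha - eps / 2 -> variance_bound X alpha eps K ->
  cube t -> {ae P, forall w, (fun m => X (dyfloor m t) w) @ \oo --> Z w} ->
  {ae P, forall w, Z w = X t w}.
Proof.
move=> K0 a0 aE XK ct XZ.
pose u m w : \bar R := ((X (dyfloor m t) w - X t w) ^+ 2)%:E.
have mu m : measurable_fun setT (u m).
  by apply/measurable_EFinP/measurable_funX; exact: measurable_funB.
have mZ : measurable_fun setT (fun w => ((Z w - X t w) ^+ 2)%:E).
  by apply/measurable_EFinP/measurable_funX; exact: measurable_funB.
pose c := K `^ 2^-1 * n%:R `^ a; pose q : R := 2 `^ (- a).
have /andP[q0 q1] : 0 < q < 1 by exact: exp2N_lt1.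
have ule m : (\int[P]_w u m w <= ((c * q ^+ m) ^+ 2)%:E)%E.
  have := variance_dyclose K0 a0 aE XK ct (dyadic_cube (dyfloor_dyadic m ct)) _.
  by rewrite unlock; apply; rewrite dyclose_sym; exact: dyfloor_close.
have cq : (fun m => ((c * q ^+ m) ^+ 2)%:E) @ \oo --> (0 : \bar R)%E.
  apply: cvg_EFin; first by near=> m.
  rewrite [X in X @ _ --> _](_ : _ = fun m => c ^+ 2 * (q ^+ 2) ^+ m); last first.
    by apply/funext => m /=; rewrite exprMn exprAC.
  rewrite -[X in _ --> X](mulr0 (c ^+ 2)); apply: cvgMr.
  by apply: cvg_expr; rewrite ger0_norm ?sqr_ge0 // expr_lt1 // ltW.
have iu : (fun m => \int[P]_w u m w)%E @ \oo --> (0 : \bar R)%E.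
  apply: (squeeze_cvge _ (cvg_cst _) cq); near=> m.
  by rewrite ule andbT integral_ge0 // => w _; rewrite lee_fin sqr_ge0.
have Z0 : (\int[P]_w ((Z w - X t w) ^+ 2)%:E = 0)%E.
  apply/eqP; rewrite eq_le integral_ge0 ?andbT; last first.
    by move=> w _; rewrite lee_fin sqr_ge0.
  have u0 m w : setT w -> (0 <= u m w)%E by rewrite lee_fin sqr_ge0.
  have F := fatou P measurableT mu u0.
  rewrite (is_cvg_limn_einfE _) in F; last by apply/cvg_ex; exists 0%E.
  rewrite (cvg_lim _ iu) // in F; apply: le_trans F.
  apply: ae_ge0_le_integral => //.
  - by move=> w _; rewrite lee_fin sqr_ge0.
  - move=> w _; rewrite limn_einf_lim; apply: lime_ge; first exact: is_cvg_einfs.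
    by apply: nearW => m; apply: le_ereal_inf_tmp => _ [k _ <-]; exact: u0.
  - apply: (emeasurable_fun_cvg (fun m w => einfs (u^~ w) m)) => [m|w _].
      exact: measurable_fun_einfs.
    by rewrite limn_einf_lim; exact: is_cvg_einfs.
  move: XZ; apply: filterS => w XZw _.
  have uw : (fun m => u m w) @ \oo --> ((Z w - X t w) ^+ 2)%:E.
    apply: cvg_EFin; first by near=> m.
    by apply: cvgM; apply: cvgB => //; exact: cvg_cst.
  rewrite is_cvg_limn_einfE; last by apply/cvg_ex; eexists; exact: uw.
  by rewrite (cvg_lim _ uw).
have : ae_eq P setT (fun w => ((Z w - X t w) ^+ 2)%:E) (cst 0%E).
  apply/(ae_eq_integral_abs _ measurableT mZ); rewrite -[RHS]Z0.
  by apply: eq_integral => w _; rewrite gee0_abs // lee_fin sqr_ge0.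
apply: filterS => w /(_ I) /= [] /eqP.
by rewrite sqrf_eq0 subr_eq0 => /eqP.
Unshelve. all: by end_near. Qed.

Lemma ae_modification X Y : (forall t, cube t -> {ae P, forall w, Y t w = X t w}) ->
  modification X Y.
Proof.
move=> XY t ct; set E := [set w | Y t w = X t w].
have mE : measurable E by exact: measurable_RV_eq.
have : P (~` E) = 0%E.
  apply/(negligibleP _ (measurableC mE)); apply: negligibleS (XY t ct).
  by move=> w.
by rewrite probability_setC // => /eqP; rewrite sube_eq //= ?add0e => /eqP <-.
Qed.

End kolmogorov_modification.

(** * Kolmogorov's continuity theorem *)

Section kolmogorov_theorem.
Context {R : realType} {n : nat} {d : measure_display} {T : measurableType d}
  {P : probability T R}.
Implicit Types (X Y : 'rV[R]_n -> {RV P >-> R}).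

Lemma dyadic_energy_fin X (C0 iota alpha g : R) :
  0 < C0 -> hypercontractive X C0 iota ->
  (forall eps : R, 0 < eps -> exists K : R, 0 < K /\ variance_bound X alpha eps K) ->
  0 < g -> g < alpha ->
  exists p, (0 < p)%N /\ {ae P, forall w, (dyadic_energy X (2 `^ (- g)) p w < +oo)%E}.
Proof.
(* The slack [alpha - g] gives standard deviations the exponent [(alpha + g) / 2], strictly above
   [g]. *)
move=> C00 hX XK g0 ga; have [K [K0 VK]] := XK (alpha - g) ltac:(lra).
have aE : (alpha + g) / 2 = alpha - (alpha - g) / 2 by field.
have [A [p0 [A0 p00 /(_ p0 (leqnn _)) WA]]] := dyadic_energy_moments C00 hX K0 VK aE g0 ltac:(lra).
exists p0; split => //; have /andP[r0 _] := exp2N_lt1 g0.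
by apply: dyadic_energy_ae_fin => //; apply: le_lt_trans WA _; exact: ltry.
Qed.

Lemma measurable_fin_set (W : T -> \bar R) : measurable_fun setT W ->
  measurable [set w | (W w < +oo)%E].
Proof.
move=> mW; have := mW measurableT _ (emeasurable_itv `]-oo, (+oo : \bar R)%E[).
by rewrite setTI; congr measurable; apply/seteqP; split => w /=; rewrite in_itv.
Qed.

Lemma kolmogorov_modification X (C0 iota alpha : R) :
  0 < C0 -> 0 < alpha -> hypercontractive X C0 iota ->
  (forall eps : R, 0 < eps -> exists K : R, 0 < K /\ variance_bound X alpha eps K) ->
  exists Y, modification X Y /\ holder_below Y alpha.
Proof.
move=> C00 a0 hX XK.
(* A single exponent, here [alpha / 2], fixes the event on which the modification is a limit of grid
   values. The energies of all other exponents then estimate this same field. *)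
have h0 : 0 < alpha / 2 by lra.
have [p0 [p00 W0fin]] := dyadic_energy_fin C00 hX XK h0 ltac:(lra).
have r01 := exp2N_lt1 h0; have /andP[r0 r1] := r01.
set W0 := dyadic_energy X (2 `^ (- (alpha / 2))) p0 in W0fin.
have mW0 : measurable_fun setT W0 by exact: measurable_dyadic_energy.
pose G := [set w | (W0 w < +oo)%E].
have mG : measurable G by exact: measurable_fin_set.
have ex t : exists Z : {RV P >-> R}, cube t -> forall w, (W0 w < +oo)%E ->
    (fun m => X (dyfloor m t) w) @ \oo --> Z w.
  have [ct|nct] := pselect (cube t); last by exists (X t).
  (* The indicator of the good event makes the sequence converge everywhere, so that its limit is
     measurable. *)
  pose h m w := X (dyfloor m t) w * \1_G w.
  have cG w : (W0 w < +oo)%E -> cvgn (fun m => X (dyfloor m t) w).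
    move=> Ww; have B0 : 0 <= 1 + fine (W0 w).
      by rewrite addr_ge0 // fine_ge0 // dyadic_energy_ge0.
    exact: (grid_modulus_cvg r01 B0 (dyadic_energy_fin_modulus r0 p00 Ww) ct).
  have [|Z ZE] := @measurable_RV _ _ _ P _ _ (fun w => limn (h^~ w)).
    have mh m : measurable_fun setT (h m).
      by apply: measurable_funM => //; exact: measurable_indic.
    apply: (measurable_fun_cvg mh) => w _.
    rewrite /h; have [wG|wG] := pselect (G w); last first.
      have -> : (fun m => X (dyfloor m t) w * \1_G w) = fun=> 0.
        by apply/funext => m; rewrite indicE memNset // mulr0.
      exact: is_cvg_cst.
    rewrite indicE mem_set //.
    have -> : (fun m => X (dyfloor m t) w * 1%:R) = (fun m => X (dyfloor m t) w).
      by apply/funext => m; rewrite mulr1.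
    exact: cG.
  exists Z => _ w Ww; rewrite ZE /h indicE mem_set //.
  have -> : (fun m => X (dyfloor m t) w * 1%:R) = (fun m => X (dyfloor m t) w).
    by apply/funext => m; rewrite mulr1.
  exact: cG.
have [Y Ylim] := choice ex.
exists Y; split.
  apply: ae_modification => t ct.
  have [K [K0 VK]] := XK alpha a0.
  apply: (@dyfloor_limit_ae _ _ _ _ _ _ _ _ _ _ (alpha / 2) _ K0 _ _ VK) => //.
    by field.
  by move: W0fin; apply: filterS => w; exact: Ylim.
move=> eps eps0; pose e := Num.min eps (alpha / 2).
have e0 : 0 < e by rewrite lt_min eps0.
have e1 : e <= eps by rewrite ge_min lexx.
have e2 : e <= alpha / 2 by rewrite ge_min lexx orbT.
have g0 : 0 < alpha - e by lra.
have [p [pgt0 Wfin]] := dyadic_energy_fin C00 hX XK g0 ltac:(lra).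
have /andP[s0 s1] := exp2N_lt1 g0.
set W := dyadic_energy X _ p in Wfin.
pose c := 3 / (1 - 2 `^ (- (alpha - e))) * 2 `^ (alpha - e) * n%:R `^ (eps - e).
have c0 : 0 <= c by rewrite !mulr_ge0 ?powR_ge0 // invr_ge0 subr_ge0 ltW.
have [|C CE] := @measurable_RV _ _ _ P _ _ (fun w => c%:E * (1 + W w))%E.
  apply: emeasurable_funM => //; apply: emeasurable_funD => //.
  exact: measurable_dyadic_energy.
exists C; split.
  move: Wfin; apply: filterS => w Ww; rewrite CE fin_numM // fin_numD /=.
  by rewrite ge0_fin_numE // dyadic_energy_ge0.
move: Wfin W0fin; apply: filterS2 => w Ww W0w s t cs ct st.
have Wge0 : (0 <= W w)%E by exact: dyadic_energy_ge0.
have Wf : (W w \is a fin_num) by rewrite ge0_fin_numE.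
have B0 : 0 <= 1 + fine (W w) by rewrite addr_ge0 // fine_ge0.
have := grid_modulus_holder g0 B0 (dyadic_energy_fin_modulus s0 pgt0 Ww) cs ct st
  (Ylim s cs w W0w) (Ylim t ct w W0w).
move=> YY; rewrite CE -(fineK Wf) -EFinD -!EFinM lee_fin; apply: (le_trans YY).
have hh : enorm (t - s) `^ (alpha - e) <=
    n%:R `^ (eps - e) * enorm (t - s) `^ (alpha - eps).
  have -> : alpha - e = (eps - e) + (alpha - eps) by ring.
  have ep := enorm_gt0 st.
  rewrite powRD ?(gt_eqF ep) ?implybT // ler_wpM2r ?powR_ge0 //.
  apply: ge0_ler_powR; rewrite ?nnegrE ?enorm_ge0 ?subr_ge0 //.
  exact: enorm_cube.
rewrite /c -!mulrA; do 3!rewrite ler_wpM2l ?powR_ge0 ?invr_ge0 ?subr_ge0 ?(ltW s1) //.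
by rewrite mulrCA ler_wpM2l.
Qed.

End kolmogorov_theorem.

(** * From growth of moments to an exponential moment *)

Section exponential_moment.
Context {R : realType} {d : measure_display} {T : measurableType d}
  {P : probability T R}.

(** Expanding the exponential would bring in fractional moments of S. Instead, each point picks one
    integer p, and the term of index p alone dominates the exponential there unless p < [p0], where
    a constant does. The sum of all terms is integrable whatever [N] and [p0] are, so the threshold
    involves only [A] and [iota]. *)
Lemma exp_moment (S : T -> R) (A N iota : R) p0 :
  measurable_fun setT S -> (forall w, 0 <= S w) -> 0 < iota -> 0 < A -> 0 <= N ->
  (0 < p0)%N ->
  (forall p, (p0 <= p)%N ->
    (\int[P]_w (S w ^+ p)%:E <= (N * (A * p%:R `^ iota) ^+ p)%:E)%E) ->
  forall beta, 0 <= beta -> beta <= (expR 1 * A) `^ (- iota^-1) / 2 ->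
  (\int[P]_w (expR (beta * S w `^ iota^-1))%:E < +oo)%E.
Proof.
move=> mS S0 i0 A0 N0 p00 SA beta b0; set c := _ `^ _ => bc.
have eA0 : 0 < expR 1 * A by rewrite mulr_gt0 ?expR_gt0.
have c0 : 0 < c by exact: powR_gt0.
(* The factor e brings the p-th moment of S / D down to at most N e^-p. After the weight
   exp((p+1)/2) in [t], a geometric series of ratio e^-(1/2) remains. *)
pose D (p : nat) : R := expR 1 * A * p%:R `^ iota.
have D0 k : 0 < D (k + p0)%N.
  by rewrite mulr_gt0 // powR_gt0 // ltr0n addn_gt0 p00 orbT.
pose t (k : nat) w : \bar R :=
  ((expR ((k + p0).+1%:R / 2))%:E * ((D (k + p0)%N ^- (k + p0))%:E * (S w ^+ (k + p0))%:E))%E.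
have mSp p : measurable_fun setT (fun w => (S w ^+ p)%:E).
  by apply/measurable_EFinP/measurable_funX.
have tge0 k w : (0 <= t k w)%E.
  by rewrite /t -!EFinM lee_fin !mulr_ge0 ?expR_ge0 ?invr_ge0 ?exprn_ge0 // ltW.
have mt k : measurable_fun setT (t k).
  by apply: emeasurable_funM => //; apply: emeasurable_funM.
(* With p the integer part of c S^(1/iota), S dominates (p / c)^iota, so the
   p-th power below is at least 1. *)
have key w : ((expR (beta * S w `^ iota^-1))%:E <=
    (expR (p0%:R / 2))%:E + \sum_(0 <= k <oo) t k w)%E.
  set x := S w `^ iota^-1; have x0 : 0 <= x by exact: powR_ge0.
  have cx0 : 0 <= c * x by rewrite mulr_ge0 // ltW.
  have [h1 h2] := truncn_bounds cx0; set p := Num.truncn (c * x) in h1 h2.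
  have bx : beta * x <= p.+1%:R / 2.
    apply: (@le_trans _ _ (c / 2 * x)); first by rewrite ler_wpM2r.
    by rewrite -[p.+1%:R]natr1 mulrAC ler_wpM2r // ltW.
  have [pp0|pp0] := ltnP p p0.
    apply: (@le_trans _ _ (expR (p0%:R / 2))%:E).
      rewrite lee_fin ler_expR; apply: (le_trans bx).
      by rewrite ler_wpM2r // ler_nat.
    by apply: leeDl; exact: nneseries_ge0.
  apply: (@le_trans _ _ (t (p - p0)%N w)); last first.
    rewrite (@nneseriesD1 _ _ (p - p0)%N) //.
    apply: (@le_trans _ _ (t (p - p0)%N w +
        \sum_(0 <= k <oo | xpredT k && (k != (p - p0)%N)) t k w)%E).
      by apply: leeDl; exact: nneseries_ge0.
    by apply: leeDr; rewrite lee_fin expR_ge0.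
  rewrite /t subnK // -!EFinM lee_fin.
  apply: (@le_trans _ _ (expR (p.+1%:R / 2))); first by rewrite ler_expR.
  rewrite ler_peMr ?expR_ge0 // mulrC -expr_div_n exprn_ege1 //.
  have Dp : 0 < D p by rewrite -(subnK pp0); exact: D0.
  rewrite ler_pdivlMr // mul1r.
  have -> : S w = x `^ iota.
    by rewrite /x -powRrM mulVf ?gt_eqF // powRr1.
  have -> : D p = (p%:R / c) `^ iota.
    rewrite powRM ?invr_ge0 ?(ltW c0) // /D mulrC; congr (_ * _).
    rewrite -powR_inv1 ?(ltW c0) // -powRrM /c -powRrM mulN1r mulrNN mulVf ?gt_eqF //.
    by rewrite powRr1 // ltW.
  apply: ge0_ler_powR; rewrite ?nnegrE ?(ltW i0) // ?divr_ge0 ?(ltW c0) //.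
  by rewrite ler_pdivrMr // mulrC.
apply: (@le_lt_trans _ _ (\int[P]_w ((expR (p0%:R / 2))%:E + \sum_(0 <= k <oo) t k w))%E).
  apply: ge0_le_integral => //.
  - apply/measurable_EFinP/measurableT_comp => //; apply: measurable_funM => //.
    apply: (@measurableT_comp _ _ _ _ _ _ (fun y : R => y `^ iota^-1) _ S).
      exact: measurable_powR.
    exact: mS.
  - apply: emeasurable_funD => //.
    by apply: ge0_emeasurable_sum => // k w _ _.
rewrite ge0_integralD //; first last.
- by apply: ge0_emeasurable_sum => // k w _ _.
- by move=> w _; exact: nneseries_ge0.
rewrite probability_integral_cst integral_nneseries //.
apply: lte_add_pinfty; first exact: ltry.
pose q : R := expR (- 2^-1).
have q01 : 0 < q < 1 by rewrite expR_gt0 /= expR_lt1; lra.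
have /andP[q0 q1] := q01.
apply: (@le_lt_trans _ _ (N * expR 2^-1 / (1 - q))%:E); last exact: ltry.
apply: nneseries_le => [k|M]; first by apply: integral_ge0.
apply: (@le_trans _ _ (\sum_(0 <= k < M) (N * expR 2^-1 * q ^+ k)%:E)%E).
  apply: lee_sum => k _; set p := (k + p0)%N.
  rewrite /t ge0_integralZl //; first last.
  - by move=> w _; rewrite -EFinM lee_fin mulr_ge0 ?invr_ge0 ?exprn_ge0 // ltW.
  - by apply: emeasurable_funM.
  rewrite ge0_integralZl //; first last.
  - by rewrite lee_fin invr_ge0 exprn_ge0 // ltW.
  - by move=> w _; rewrite lee_fin exprn_ge0.
  rewrite -/p.
  apply: (@le_trans _ _ ((expR (p.+1%:R / 2))%:E *
      ((D p ^- p)%:E * (N * (A * p%:R `^ iota) ^+ p)%:E))%E).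
    apply: lee_wpmul2l; first by rewrite lee_fin expR_ge0.
    apply: lee_wpmul2l; first by rewrite lee_fin invr_ge0 exprn_ge0 // ltW // D0.
    by apply: SA; rewrite leq_addl.
  rewrite -!EFinM lee_fin.
  have -> : D p ^- p * (N * (A * p%:R `^ iota) ^+ p) = N * expR (- p%:R).
    rewrite mulrCA; congr (N * _); rewrite expRN.
    have -> : D p = expR 1 * (A * p%:R `^ iota) by rewrite mulrA.
    rewrite exprMn invfM mulfVK; last first.
      by rewrite expf_neq0 // gt_eqF // mulr_gt0 // powR_gt0 // ltr0n addn_gt0 p00 orbT.
    by rewrite -expRM_natl mulr1.
  rewrite mulrCA -[leRHS]mulrA ler_wpM2l // -expRD /q -expRM_natl -expRD ler_expR.
  by rewrite /p -[_.+1%:R]natr1 natrD; have : 0 <= p0%:R :> R by []; lra.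
rewrite sumEFin lee_fin; apply: geometric_le_lim => //; last by rewrite ger0_norm // ltW.
by rewrite mulr_ge0 ?expR_ge0.
Qed.

End exponential_moment.

(** * Splitting the increments at a level *)

Section two_scale.
Context {R : realType} {n : nat}.
Implicit Types (m k : nat) (s t u v : 'rV[R]_n) (f : 'rV[R]_n -> R).

(** As [eps] is arbitrary, [gamma] may be negative, and then the lower comparison of [x] with [y] is
    the useful one. *)
Lemma powR_comparable (c x y gamma : R) : 0 < x -> 0 < y -> 0 < c ->
  x <= c * y -> y <= c * x -> x `^ gamma <= c `^ `|gamma| * y `^ gamma.
Proof.
move=> x0 y0 c0 xy yx; have [g0|g0] := leP 0 gamma.
  rewrite ger0_norm // -powRM ?(ltW c0) ?(ltW y0) //.
  by apply: ge0_ler_powR; rewrite ?nnegrE ?mulr_ge0 // ltW.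
rewrite ltr0_norm //; have [a aE] : exists a, gamma = - a by exists (- gamma); rewrite opprK.
have a0 : 0 <= a by rewrite aE oppr_lt0 in g0; exact: ltW.
rewrite aE.
have yx' : y `^ a <= c `^ a * x `^ a.
  rewrite -powRM ?(ltW c0) ?(ltW x0) //.
  by apply: ge0_ler_powR; rewrite ?nnegrE ?mulr_ge0 // ltW.
rewrite opprK !powRN -[(x `^ a)^-1]div1r ler_pdivrMr ?powR_gt0 //.
by rewrite mulrAC ler_pdivlMr ?powR_gt0 // mul1r.
Qed.

(** For negative [gamma] the weight h^gamma is bounded below on the cube, and 1 takes the place of
    the power of 2^-k; hence the positive part of [gamma] on the left. *)
Lemma exp2_le_powR (gamma h : R) k : (0 < n)%N -> (2 ^+ k.+1)^-1 <= h -> h <= n%:R ->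
  (2 ^+ k)^-1 `^ (Num.max gamma 0) <= (2 * n%:R) `^ `|gamma| * h `^ gamma.
Proof.
move=> n0 kh hn; have h0 : 0 < h.
  by apply: lt_le_trans kh; rewrite invr_gt0 exp2_gt0.
have n1 : 1 <= n%:R :> R by rewrite ler1n.
have [g0|g0] := leP 0 gamma.
  rewrite ger0_norm // -powRM ?(ltW h0) ?mulr_ge0 //.
  apply: ge0_ler_powR; rewrite ?nnegrE ?inv_exp2_ge0 // ?mulr_ge0 ?(ltW h0) //.
  have : (2 ^+ k)^-1 <= 2 * h.
    by rewrite -ler_pdivrMl // -invfM -exprS.
  move=> /le_trans; apply; rewrite -mulrA ler_wpM2l //.
  by rewrite ler_peMl // ltW.
rewrite powRr0 ltr0_norm //; have [a aE] : exists a, gamma = - a by exists (- gamma); rewrite opprK.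
have a0 : 0 <= a by rewrite aE oppr_lt0 in g0; exact: ltW.
rewrite aE.
rewrite opprK powRN ler_pdivlMr ?powR_gt0 // mul1r.
apply: ge0_ler_powR; rewrite ?nnegrE ?mulr_ge0 ?(ltW h0) //.
by apply: (le_trans hn); rewrite ler_peMl // ler1n.
Qed.

(* L does not depend on the modulus B nor on the level m.  The net has level m + 2
   so that two points at distance larger than 2^-m keep comparable distance when
   rounded to the net. *)
Lemma two_scale (g gamma : R) : (0 < n)%N -> 0 < g -> gamma < g ->
  exists L c rho : R, [/\ 0 <= L, 0 <= c, 0 < rho < 1 & forall f (B M : R) m,
    0 <= B -> 0 <= M -> grid_modulus f B (2 `^ (- g)) ->
    (forall u v, dyadic m.+2 u -> dyadic m.+2 v -> u <> v ->
      `|f v - f u| <= M * enorm (v - u) `^ gamma) ->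
    forall l s t, dyadic l s -> dyadic l t -> s <> t ->
      `|f t - f s| <= (L * M + c * B * rho ^+ m) * enorm (t - s) `^ gamma].
Proof.
move=> n0 g0 gg; pose gp := Num.max gamma 0.
have gpg : 0 < g - gp by rewrite subr_gt0 /gp gt_max gg.
have gp0 : 0 <= gp by rewrite le_max lexx orbT.
have r01 := exp2N_lt1 g0; set r := 2 `^ (- g) in r01; have /andP[r0 r1] := r01.
have rho01 := exp2N_lt1 gpg; set rho := 2 `^ (- (g - gp)) in rho01.
have /andP[rho0 rho1] := rho01.
pose c1 := 3 / (1 - r); pose C2 : R := (2 * n%:R) `^ `|gamma|.
have c10 : 0 <= c1 by rewrite divr_ge0 // subr_ge0 ltW.
have C20 : 0 <= C2 by exact: powR_ge0.
have n1 : 1 <= n%:R :> R by rewrite ler1n.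
exists ((4 * n%:R) `^ `|gamma|), (2 * c1 * C2), rho; split => //.
- by rewrite mulr_ge0 // mulr_ge0.
move=> f B M m B0 M0 fB fM l s t ds dt st.
have cB0 : 0 <= c1 * B by exact: mulr_ge0.
have cs := dyadic_cube ds; have ct := dyadic_cube dt.
have [k [kst hk]] := dyclose_scale cs ct st.
have kh := Ndyclose_enorm hk.
set h := enorm (t - s) in kh *; have h0 : 0 < h by exact: enorm_gt0.
have hn : h <= n%:R by exact: enorm_cube.
(* The decay splits into a gain, [rho ^+ j], and a factor of exponent [gp] which the weight h^gamma
   dominates at the scale of the pair. *)
have rE j : r ^+ j = rho ^+ j * (2 ^+ j)^-1 `^ gp.
  rewrite /r /rho !exp2N_exp -powRD ?subrK // ?invr_eq0 ?expf_neq0 ?implybT //.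
have mono i j : (i <= j)%N -> (2 ^+ j)^-1 `^ gp <= (2 ^+ i)^-1 `^ gp :> R.
  move=> ij; apply: ge0_ler_powR; rewrite ?nnegrE ?inv_exp2_ge0 //.
  by rewrite lef_pV2 ?posrE ?exp2_gt0 // ler_eXn2l // ltr1n.
have Q : (2 ^+ k)^-1 `^ gp <= C2 * h `^ gamma by apply: exp2_le_powR => //; exact: ltW.
have main j : (m <= j)%N -> (k <= j)%N -> r ^+ j <= rho ^+ m * (C2 * h `^ gamma).
  move=> mj kj; rewrite rE; apply: ler_pM; rewrite ?exprn_ge0 ?powR_ge0 ?(ltW rho0) //.
    by rewrite ler_wiXn2l // ltW.
  exact: le_trans (mono _ _ kj) Q.
have hg0 : 0 <= h `^ gamma by exact: powR_ge0.
(* If [m <= k], chaining alone bounds the increment. Otherwise both points are rounded to the net,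
   which costs one fine term each, whence the 2 in the constant. *)
rewrite mulrDl; have [mk|km] := leqP m k.
  rewrite distrC; have := grid_modulus_dyadic r01 B0 fB ds dt kst.
  move=> /le_trans; apply.
  apply: (@le_trans _ _ (c1 * B * (rho ^+ m * (C2 * h `^ gamma)))).
    by rewrite -/c1 ler_wpM2l //; exact: main.
  have -> : 2 * c1 * C2 * B * rho ^+ m * h `^ gamma =
     2 * (c1 * B * (rho ^+ m * (C2 * h `^ gamma))) by ring.
  set Z := c1 * B * _; have Z0 : 0 <= Z by rewrite mulr_ge0 // !mulr_ge0 ?exprn_ge0 // ltW.
  have : 0 <= (4 * n%:R) `^ `|gamma| * M * h `^ gamma by rewrite !mulr_ge0 ?powR_ge0.
  lra.
have ds' := dyfloor_dyadic m.+2 cs; have dt' := dyfloor_dyadic m.+2 ct.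
set s' := dyfloor m.+2 s in ds'; set t' := dyfloor m.+2 t in dt'.
have sc : dyclose m.+2 s s' by rewrite dyclose_sym; exact: dyfloor_close.
have tc : dyclose m.+2 t t' by rewrite dyclose_sym; exact: dyfloor_close.
(* As [k < m], the net has level at least k + 3: rounding both points moves a coordinate of [t - s]
   by at most 2^-k / 4, while some coordinate exceeds 2^-k / 2 in size. *)
have e4 : (2 ^+ m.+2)^-1 <= (2 ^+ k)^-1 / 8 :> R.
  have -> : (2 ^+ k)^-1 / 8 = (2 ^+ k.+3)^-1 :> R.
    by rewrite !exprS; field; rewrite exp2_neq0.
  by rewrite lef_pV2 ?posrE ?exp2_gt0 // ler_eXn2l // ltr1n.
have hk' : (2 ^+ k)^-1 / 2 < h by rewrite -invfM -exprSr.
have ek0 : 0 < (2 ^+ k)^-1 :> R by rewrite invr_gt0 exp2_gt0.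
have st'i i : `|(t' - s') ord0 i - (t - s) ord0 i| <= (2 ^+ k)^-1 / 4.
  move/forallP: sc => /(_ i); move/forallP: tc => /(_ i).
  rewrite !mxE -/s' -/t' !ler_norml; lra.
have h'le : enorm (t' - s') <= n%:R * (2 * (2 ^+ k)^-1).
  apply: enorm_le => [|i]; first by rewrite mulr_ge0 // ltW.
  have := st'i i; move/forallP: kst => /(_ i); rewrite !mxE !ler_norml; lra.
have hle : h <= n%:R * (2 ^+ k)^-1 by exact: dyclose_enorm.
have [i ki] : exists i, (2 ^+ k)^-1 / 4 < `|(t' - s') ord0 i|.
  have /forallPn[i] := hk; rewrite -ltNge exprSr invfM distrC => ki; exists i.
  have := st'i i; have := ler_distD ((t' - s') ord0 i) ((t - s) ord0 i) 0.
  rewrite !subr0 distrC [X in _ <= _ + X]/= => h1 h2; move: ki h1; rewrite !mxE in h2 *; lra.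
have h'ge : (2 ^+ k)^-1 / 4 < enorm (t' - s') := lt_le_trans ki (le_enorm _ _).
have st' : s' <> t'.
  move=> e; move: ki; rewrite e subrr mxE normr0 ltNge divr_ge0 //; exact: ltW.
have h'0 : 0 < enorm (t' - s') by apply: lt_trans h'ge; rewrite divr_gt0.
have net : `|f t' - f s'| <= (4 * n%:R) `^ `|gamma| * M * h `^ gamma.
  apply: (le_trans (fM _ _ ds' dt' st')); rewrite mulrAC mulrC ler_wpM2r //.
  apply: powR_comparable; rewrite // ?mulr_gt0 ?ltr0n //.
    apply: (le_trans h'le); rewrite [4 * _]mulrC -mulrA ler_wpM2l //.
    by move: hk'; lra.
  apply: (le_trans hle); rewrite [4 * _]mulrC -mulrA ler_wpM2l //.
  by move: h'ge; lra.
have app u v : dyadic l u -> dyadic m.+2 v -> dyclose m.+2 u v ->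
    `|f u - f v| <= c1 * B * (rho ^+ m * (C2 * h `^ gamma)).
  move=> du dv uv; have du' := dyadic_le (leq_maxl l m.+2) du.
  have dv' := dyadic_le (leq_maxr l m.+2) dv.
  apply: (le_trans (grid_modulus_dyadic r01 B0 fB du' dv' uv)).
  rewrite -/c1 ler_wpM2l //; apply: main; first by rewrite -addn2 leq_addr.
  by apply: ltnW; apply: (leq_trans km); rewrite -addn2 leq_addr.
have as' := app _ _ ds ds' sc; have at' := app _ _ dt dt' tc.
have -> : 2 * c1 * C2 * B * rho ^+ m * h `^ gamma =
    c1 * B * (rho ^+ m * (C2 * h `^ gamma)) +
    c1 * B * (rho ^+ m * (C2 * h `^ gamma)) by ring.
have := ler_distD (f t') (f t) (f s); move=> /le_trans; apply.
have := ler_distD (f s') (f t') (f s); move=> dd.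
rewrite [`|f s' - f s|]distrC in dd.
apply: (le_trans (lerD at' dd)); move: net as'; lra.
Qed.

End two_scale.

(** * Reduction of the Hoelder constant to dyadic pairs *)

Section dyadic_supremum.
Context {R : realType} {n : nat} {d : measure_display} {T : measurableType d}
  {P : probability T R}.
Implicit Types (X Y : 'rV[R]_n -> {RV P >-> R}).

(* Pairs of equal points contribute 0, as the numerator vanishes. *)
Definition dyadic_ratio Y (gamma : R) (k : nat) (w : T) : \bar R :=
  if unpickle k is Some x then
    let: existT m fg := x : {m : nat & @grid_index n m * @grid_index n m}%type in
    (`|Y (grid_point fg.2) w - Y (grid_point fg.1) w| /
      enorm (grid_point fg.2 - grid_point fg.1) `^ gamma)%:E
  else 0%E.

(** The supremum over all dyadic pairs, written as a tail supremum from index 0 of an enumeration,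
    so that it is measurable. *)
Definition dyadic_holder Y (gamma : R) (w : T) : \bar R :=
  esups ((dyadic_ratio Y gamma)^~ w) 0.

Lemma measurable_dyadic_holder Y gamma : measurable_fun setT (dyadic_holder Y gamma).
Proof.
apply: measurable_fun_esups => k; rewrite /dyadic_ratio.
case: unpickle => [[m fg]|]; last exact: measurable_cst.
apply/measurable_EFinP/measurable_funM => //.
by apply: measurableT_comp => //; exact: measurable_funB.
Qed.

Lemma dyadic_holder_ub Y gamma w l s t : dyadic l s -> dyadic l t ->
  ((`|Y t w - Y s w| / enorm (t - s) `^ gamma)%:E <= dyadic_holder Y gamma w)%E.
Proof.
move=> [f ->] [g ->]; apply: ereal_sup_ubound.
exists (pickle (existT _ l (f, g) : {m : nat & @grid_index n m * @grid_index n m}%type)) => //.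
by rewrite /dyadic_ratio pickleK.
Qed.

Lemma dyadic_holder_le Y gamma w (x : \bar R) : (0 <= x)%E ->
  (forall l s t, dyadic l s -> dyadic l t -> s <> t ->
    (`|Y t w - Y s w| / enorm (t - s) `^ gamma)%:E <= x)%E ->
  (dyadic_holder Y gamma w <= x)%E.
Proof.
move=> x0 H; apply: ge_ereal_sup => _ [k _ <-]; rewrite /dyadic_ratio.
case: unpickle => [[m [f g]]|] //=.
have [e|/eqP fg] := eqVneq (grid_point f) (grid_point g : 'rV[R]_n).
  by rewrite e subrr normr0 mul0r.
by apply: (H m); [exists f|exists g|].
Qed.

Lemma dyadic_holder_ge0 Y gamma w : (0 <= dyadic_holder Y gamma w)%E.
Proof.
have d0 : dyadic 0 (0 : 'rV[R]_n).
  apply/dyadicP; split => i; first by rewrite mxE lexx ler01.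
  by exists 0; rewrite mxE mul0r.
by have := dyadic_holder_ub Y gamma w d0 d0; rewrite subrr normr0 mul0r.
Qed.

Lemma dyfloor_cvg (t : 'rV[R]_n) i : cube t ->
  (fun m => dyfloor m t ord0 i) @ \oo --> (t ord0 i : R).
Proof.
move=> ct; apply/cvgrPdist_le => e e0.
have /cvgrPdist_le/(_ e e0) : (fun k => (2^-1) ^+ k) @ \oo --> (0 : R).
  by apply: cvg_expr; rewrite ger0_norm // invf_lt1 // ltr1n.
apply: filterS => m; rewrite sub0r normrN => me.
have /forallP/(_ i) := dyfloor_close m ct; rewrite distrC => /le_trans; apply.
by apply: le_trans me; rewrite exprVn ler_norm.
Qed.

Lemma enorm_dyfloor_cvg (s t : 'rV[R]_n) : cube s -> cube t ->
  (fun m => enorm (dyfloor m t - dyfloor m s)) @ \oo --> (enorm (t - s) : R).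
Proof.
move=> cs ct; rewrite /enorm; apply: (@cvg_comp _ _ _ _ Num.sqrt); last first.
  exact: sqrt_continuous.
apply: cvg_big => [|i _]; first exact: add_continuous.
have -> : (fun m => (dyfloor m t - dyfloor m s) ord0 i ^+ 2) =
    (fun m => (dyfloor m t ord0 i - dyfloor m s ord0 i) ^+ 2).
  by apply/funext => m; rewrite !mxE.
by rewrite !mxE; apply: cvgM; apply: cvgB; exact: dyfloor_cvg.
Qed.

Lemma powR_continuous (gamma x : R) : 0 < x -> {for x, continuous (fun y => y `^ gamma)}.
Proof.
move=> x0; apply: differentiable_continuous; apply/derivable1_diffP.
by apply: derivable_powR; rewrite in_itv /= x0.
Qed.

(** Each ratio is the limit of the ratios at the rounded points, numerator and weight both
    converging, the latter to a positive limit. An uncountable supremum is thus traded for a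
    measurable one. *)
Lemma holder_constant_dyadic Y gamma w : (0 < n)%N ->
  (forall t, cube t -> (fun m => Y (dyfloor m t) w) @ \oo --> Y t w) ->
  holder_constant Y gamma w = dyadic_holder Y gamma w.
Proof.
move=> n0 Yc; apply/eqP; rewrite eq_le; apply/andP; split.
  apply: ge_ereal_sup => _ [[s t] /= [cs ct st] <-].
  have e0 : 0 < enorm (t - s) by exact: enorm_gt0.
  have cv : (fun m => (`|Y (dyfloor m t) w - Y (dyfloor m s) w| /
      enorm (dyfloor m t - dyfloor m s) `^ gamma)%:E) @ \oo -->
      (`|Y t w - Y s w| / enorm (t - s) `^ gamma)%:E.
    apply: cvg_EFin; first by near=> m.
    apply: cvgM; first by apply: cvg_norm; apply: cvgB; exact: Yc.
    apply: cvgV; first by rewrite gt_eqF // powR_gt0.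
    apply: (@cvg_comp _ _ _ _ (fun y : R => y `^ gamma)); last exact: powR_continuous.
    exact: enorm_dyfloor_cvg.
  rewrite -(cvg_lim _ cv) //; apply: lime_le; first by apply/cvg_ex; eexists; exact: cv.
  apply: nearW => m; apply: (@dyadic_holder_ub _ _ _ m); exact: dyfloor_dyadic.
apply: dyadic_holder_le; last first.
  move=> l s t ds dt st; apply: ereal_sup_ubound; exists (s, t) => //.
  by split=> //=; [exact: dyadic_cube ds|exact: dyadic_cube dt].
(* Two opposite corners, distinct since n > 0, show that the supremum is not that of the empty set
   and so is nonnegative. *)
apply: (@le_trans _ _ (`|Y (const_mx 1) w - Y 0 w| / enorm (const_mx 1 - 0) `^ gamma)%:E).
  by rewrite lee_fin divr_ge0 ?powR_ge0.
apply: ereal_sup_ubound; exists (0, const_mx 1); last exact: erefl.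
split => /=.
- by move=> i; rewrite mxE lexx ler01.
- by move=> i; rewrite mxE lexx ler01.
- by move=> /rowP/(_ (Ordinal n0)); rewrite !mxE => /eqP; rewrite eq_sym oner_eq0.
Unshelve. all: by end_near. Qed.

End dyadic_supremum.

(** * Moments of the dyadic Hoelder constant *)

Section holder_constant_moments.
Context {R : realType} {n : nat} {d : measure_display} {T : measurableType d}
  {P : probability T R}.
Implicit Types (X Y : 'rV[R]_n -> {RV P >-> R}).

Lemma holder_below_dyfloor_cvg Y (alpha : R) : 0 < alpha -> holder_below Y alpha ->
  {ae P, forall w, forall t, cube t -> (fun m => Y (dyfloor m t) w) @ \oo --> Y t w}.
Proof.
move=> a0 hY; have h0 : 0 < alpha / 2 by lra.
have [C [Cfin CY]] := hY (alpha / 2) h0.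
move: Cfin CY; apply: filterS2 => w Cw CY t ct.
have /andP[q0 q1] := exp2N_lt1 h0; set q := 2 `^ _ in q0 q1.
pose c := `|fine (C w)| * n%:R `^ (alpha / 2).
have c0 : 0 <= c by rewrite mulr_ge0 ?powR_ge0.
apply/cvgrPdist_le => e e0.
have /cvgrPdist_le/(_ e e0) : (fun k => c * q ^+ k) @ \oo --> (0 : R).
  rewrite -[X in _ --> X](mulr0 c); apply: cvgMr.
  by apply: cvg_expr; rewrite ger0_norm // ltW.
apply: filterS => m; rewrite sub0r normrN => /(le_trans (ler_norm _)); apply: le_trans.
have dt := dyfloor_dyadic m ct; have cd := dyadic_cube dt.
have [->|/eqP st] := eqVneq (dyfloor m t) t.
  by rewrite subrr normr0 mulr_ge0 // exprn_ge0 // ltW.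
have := CY _ _ cd ct st; rewrite -(fineK Cw) -EFinM lee_fin => /le_trans; apply.
have -> : alpha - alpha / 2 = alpha / 2 by field.
rewrite /c -mulrA.
apply: (le_trans (ler_wpM2r (powR_ge0 _ _) (ler_norm _))).
rewrite ler_wpM2l // exp2N_exp -powRM ?inv_exp2_ge0 //.
apply: (ge0_ler_powR (ltW h0)); rewrite ?nnegrE ?enorm_ge0 ?mulr_ge0 ?inv_exp2_ge0 //.
by apply: dyclose_enorm; exact: dyfloor_close.
Qed.

(** No chaining takes place inside the net: all pairs are kept, close or not, each with the weight
    of its own distance. *)
Definition net_energy Y (gamma : R) m p (w : T) : \bar R :=
  (\sum_(fg : @grid_index n m * @grid_index n m)
    ((`|Y (grid_point fg.2) w - Y (grid_point fg.1) w| /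
      enorm (grid_point fg.2 - grid_point fg.1) `^ gamma) ^+ p)%:E)%E.

Lemma measurable_net_energy Y gamma m p : measurable_fun setT (net_energy Y gamma m p).
Proof. by apply: emeasurable_sum => fg; exact: measurable_increment. Qed.

Lemma net_energy_ge0 Y gamma m p w : (0 <= net_energy Y gamma m p w)%E.
Proof. by apply: sume_ge0 => fg _; rewrite lee_fin exprn_ge0 // divr_ge0 // powR_ge0. Qed.

Lemma exprD_le (x y : R) p : 0 <= x -> 0 <= y ->
  (x + y) ^+ p <= 2 ^+ p * (x ^+ p + y ^+ p).
Proof.
move=> x0 y0; wlog xy : x y x0 y0 / x <= y.
  move=> H; have [xy|yx] := leP x y; first exact: H.
  by rewrite addrC [X in _ * X]addrC; apply: H => //; exact: ltW.
apply: (@le_trans _ _ ((2 * y) ^+ p)).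
  by rewrite lerXn2r ?nnegrE ?addr_ge0 ?mulr_ge0 //; lra.
by rewrite exprMn ler_wpM2l ?exprn_ge0 // lerDr exprn_ge0.
Qed.

Lemma powR_inv_expr (x : R) p : (0 < p)%N -> 0 <= x -> (x `^ p%:R^-1) ^+ p = x.
Proof.
move=> p0 x0; rewrite -powR_mulrn ?powR_ge0 // -powRrM mulVf ?powRr1 //.
by rewrite pnatr_eq0 -lt0n.
Qed.

(** The p-th roots of the two energies are admissible as [M] and [B]. The long hypothesis is the
    property supplied by [two_scale], whose constants have to be fixed before the field. *)
Lemma dyadic_holder_power_le Y (g gamma L c rho : R) m p w :
  (0 < p)%N -> 0 < g -> 0 <= L -> 0 <= c -> 0 <= rho ->
  (forall f (B M : R) m,
    0 <= B -> 0 <= M -> grid_modulus f B (2 `^ (- g)) ->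
    (forall u v, dyadic m.+2 u -> dyadic m.+2 v -> u <> v ->
      `|f v - f u| <= M * enorm (v - u) `^ gamma) ->
    forall l (s t : 'rV[R]_n), dyadic l s -> dyadic l t -> s <> t ->
      `|f t - f s| <= (L * M + c * B * rho ^+ m) * enorm (t - s) `^ gamma) ->
  (dyadic_energy Y (2 `^ (- g)) p w < +oo)%E ->
  dyadic_holder Y gamma w \is a fin_num /\
  ((fine (dyadic_holder Y gamma w) ^+ p)%:E <=
    ((2 * L) ^+ p)%:E * net_energy Y gamma m.+2 p w +
    ((2 * (c * rho ^+ m)) ^+ p)%:E * dyadic_energy Y (2 `^ (- g)) p w)%E.
Proof.
move=> p0 g0 L0 c0 rho0 ts Wfin; set S := dyadic_holder Y gamma w.
have S0 : (0 <= S)%E by exact: dyadic_holder_ge0.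
have /andP[r0 r1] := exp2N_lt1 g0.
have W0 := dyadic_energy_ge0 Y p w r0.
set W := dyadic_energy _ _ _ _ in Wfin W0 *.
have WE : W = (fine W)%:E by rewrite fineK // ge0_fin_numE.
have N0 := net_energy_ge0 Y gamma m.+2 p w.
set N := net_energy _ _ _ _ _ in N0 *.
have NE : N = (fine N)%:E by rewrite fineK // /N /net_energy sumEFin.
have fN0 : 0 <= fine N by exact: fine_ge0.
have fW0 : 0 <= fine W by exact: fine_ge0.
pose B := fine W `^ p%:R^-1; pose M := fine N `^ p%:R^-1.
have B0 : 0 <= B by exact: powR_ge0.
have M0 : 0 <= M by exact: powR_ge0.
have BE : B ^+ p = fine W by exact: powR_inv_expr.
have ME : M ^+ p = fine N by exact: powR_inv_expr.
have mB : grid_modulus (fun t => Y t w) B (2 `^ (- g)).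
  by apply: (dyadic_energy_modulus r0 B0 p0); rewrite BE -WE.
have net u v : dyadic m.+2 u -> dyadic m.+2 v -> u <> v ->
    `|Y v w - Y u w| <= M * enorm (v - u) `^ gamma.
  move=> [f ->] [h ->] fh.
  have e0 : 0 < enorm (grid_point h - grid_point f : 'rV[R]_n) `^ gamma.
    by apply: powR_gt0; exact: (enorm_gt0 fh).
  rewrite -ler_pdivrMr // -(ler_pXn2r p0) ?nnegrE ?divr_ge0 ?(ltW e0) //.
  rewrite -lee_fin ME -NE /N /net_energy (bigD1 (f, h)) //=; apply: leeDl.
  apply: sume_ge0 => fg _; rewrite lee_fin; apply: exprn_ge0; apply: divr_ge0.
    exact: normr_ge0.
  exact: powR_ge0.
pose x := L * M + c * B * rho ^+ m.
have x0 : 0 <= x by rewrite addr_ge0 ?mulr_ge0 // exprn_ge0.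
have Sx : (S <= x%:E)%E.
  apply: dyadic_holder_le; first by rewrite lee_fin.
  move=> l s t ds dt st; rewrite lee_fin ler_pdivrMr ?powR_gt0 ?enorm_gt0 //.
  exact: (ts (fun u => Y u w) B M m B0 M0 mB net l s t ds dt st).
have Sfin : S \is a fin_num by rewrite ge0_fin_numE // (le_lt_trans Sx) // ltry.
split => //; rewrite WE NE -!EFinM -EFinD lee_fin.
apply: (@le_trans _ _ (x ^+ p)).
  by rewrite lerXn2r ?nnegrE ?fine_ge0 // -lee_fin fineK.
apply: (le_trans (exprD_le _ _ _)); rewrite ?mulr_ge0 ?exprn_ge0 //.
rewrite -BE -ME mulrDr -!exprMn le_eqVlt; apply/orP; left; apply/eqP.
by congr (_ ^+ p + _ ^+ p); ring.
Qed.

(** Dividing a standard deviation of exponent [alpha - eps/2] by the weight leaves h^(eps/2), at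
    most n^(eps/2) on the cube whatever the sign of [alpha - eps]. So nothing inside the p-th power
    depends on the level. *)
Lemma net_energy_moment X (C0 iota alpha eps K : R) m p :
  0 < C0 -> hypercontractive X C0 iota -> 0 < K -> 0 < eps ->
  variance_bound X alpha eps K -> (0 < p)%N ->
  (\int[P]_w net_energy X (alpha - eps) m p w <=
    (#|{: @grid_index n m * @grid_index n m}|%:R *
      (C0 * (K `^ 2^-1 * n%:R `^ (eps / 2)) * p%:R `^ iota) ^+ p)%:E)%E.
Proof.
move=> C00 hX K0 eps0 XK p0.
rewrite ge0_integral_sum //; first last.
- by move=> fg w _; rewrite lee_fin exprn_ge0 // divr_ge0 // powR_ge0.
- by move=> fg; exact: measurable_increment.
set c := (_ * _) ^+ p.
apply: (@le_trans _ _ (\sum_(fg : @grid_index n m * @grid_index n m) c%:E)%E); last first.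
  by rewrite sumEFin lee_fin sumr_const -[leLHS]mulr_natl.
apply: lee_sum => -[f g] _ /=.
set s := grid_point f; set t := grid_point g.
have cs : cube s by apply: (@dyadic_cube _ _ m); exists f.
have ct : cube t by apply: (@dyadic_cube _ _ m); exists g.
have c0 : 0 <= c by rewrite exprn_ge0 // !mulr_ge0 ?powR_ge0 // ltW.
have [e|/eqP st] := eqVneq s t.
  rewrite e [X in integral _ _ X](_ : _ = cst 0%E); last first.
    by apply/funext => w; rewrite subrr normr0 mul0r expr0n gtn_eqF.
  by rewrite integral0 lee_fin.
have h0 : 0 < enorm (t - s) by exact: enorm_gt0.
have hn : enorm (t - s) <= n%:R by exact: enorm_cube.
have V := XK s t cs ct st; set h := enorm (t - s) in h0 hn V *.
have hg0 : 0 < h `^ (alpha - eps) by exact: powR_gt0.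
have v0 : 0 <= K * h `^ (2 * alpha - eps) by rewrite mulr_ge0 ?powR_ge0 // ltW.
have mom := moment_le C00 hX cs ct p0 v0 V.
under eq_integral do rewrite expr_div_n mulrC EFinM.
rewrite ge0_integralZl //; first last.
- by rewrite lee_fin invr_ge0 exprn_ge0 // ltW.
- exact: measurable_increment_pow.
apply: le_trans (lee_wpmul2l _ mom) _; first by rewrite lee_fin invr_ge0 exprn_ge0 // ltW.
rewrite -EFinM lee_fin mulrC -expr_div_n lerXn2r ?nnegrE //.
- by rewrite divr_ge0 ?mulr_ge0 ?powR_ge0 // ltW.
- by rewrite !mulr_ge0 ?powR_ge0 // ltW.
rewrite ler_pdivrMr // powRM ?powR_ge0 ?(ltW K0) // -powRrM.
have -> : (2 * alpha - eps) / 2 = eps / 2 + (alpha - eps) by field.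
rewrite [h `^ (eps / 2 + _)]powRD ?(gt_eqF h0) ?implybT //.
have -> : C0 * p%:R `^ iota * (K `^ 2^-1 * (h `^ (eps / 2) * h `^ (alpha - eps))) =
  C0 * K `^ 2^-1 * p%:R `^ iota * h `^ (alpha - eps) * h `^ (eps / 2) by ring.
have -> : C0 * (K `^ 2^-1 * n%:R `^ (eps / 2)) * p%:R `^ iota * h `^ (alpha - eps) =
  C0 * K `^ 2^-1 * p%:R `^ iota * h `^ (alpha - eps) * n%:R `^ (eps / 2) by ring.
rewrite ler_wpM2l ?mulr_ge0 ?powR_ge0 ?(ltW C00) //.
by apply: ge0_ler_powR; rewrite ?nnegrE ?(ltW h0) // divr_ge0 // ltW.
Qed.

End holder_constant_moments.

(** * An exponential moment with a threshold uniform in the field *)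

Section main.
Context {R : realType}.

Lemma holder_exp_moment n (C0 iota alpha eps K : R) : (0 < n)%N -> 0 < C0 ->
  0 < alpha -> 0 < iota -> 0 < eps -> 0 < K ->
  exists beta0 : R, 0 < beta0 /\
  forall beta : R, 0 < beta -> beta <= beta0 ->
  forall (d : measure_display) (T : measurableType d) (P : probability T R)
      (X Y : 'rV[R]_n -> {RV P >-> R}),
    increments_L2 X -> hypercontractive X C0 iota ->
    variance_bound X alpha eps K ->
    modification X Y -> holder_below Y alpha ->
    holder_constant_exp_moment Y (alpha - eps) iota beta.
Proof.
move=> n0 C00 a0 i0 eps0 K0; set gamma := alpha - eps.
pose gp := Num.max gamma 0.
have gp0 : 0 <= gp by rewrite le_max lexx orbT.
have gpge : gamma <= gp by rewrite le_max lexx.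
have gpa : gp < alpha by rewrite gt_max a0 andbT /gamma; lra.
pose g := (gp + alpha) / 2.
have g0 : 0 < g by rewrite /g; lra.
have gg : gamma < g by rewrite /g; lra.
have ga : g < (g + alpha) / 2 by rewrite /g; lra.
have [L [c [rho [L0 c0 /andP[rho0 rho1] ts]]]] := two_scale n0 g0 gg.
pose A1 := C0 * (K `^ 2^-1 * n%:R `^ (eps / 2)).
have A10 : 0 <= A1 by rewrite !mulr_ge0 ?powR_ge0 // ltW.
(* The 2 comes from splitting the p-th power of a sum, [L * A1] bounds the net, and the summand 1 is
   room reserved for the fine scales of any field. *)
pose A := 2 * (L * A1 + 1).
have A0 : 0 < A by rewrite mulr_gt0 // ltr_wpDl // mulr_ge0.
exists ((expR 1 * A) `^ (- iota^-1) / 2); split.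
  by rewrite divr_gt0 // powR_gt0 // mulr_gt0 // expR_gt0.
move=> beta beta0 bA d T P X Y X2 hX XK XY hY.
have Y2 := modification_increments_L2 XY X2.
have hcY := modification_hypercontractive XY hX.
have YK := modification_variance_bound XY XK.
(* Seen as its own modification, the continuous field [Y] satisfies a variance bound with slack
   [alpha - g], which makes the chaining exponent positive; its constant [K1] depends on the
   field. *)
have YY : modification Y Y.
  by move=> t _; rewrite (_ : [set _ | _] = setT) ?probability_setT //; exact/seteqP.
have e10 : 0 < alpha - g by rewrite /g; lra.
have [K1 [K10 YK1]] := holder_variance_bound C00 Y2 hcY YY hY e10.
have aE : (g + alpha) / 2 = alpha - (alpha - g) / 2 by field.
have [A' [p0 [A'0 p00 WA]]] := dyadic_energy_moments C00 hcY K10 YK1 aE g0 ga.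
(* [A'] is known only here, after [A] and the threshold on [beta] have been fixed. *)
have [m cm] : exists m, c * rho ^+ m * A' <= 1.
  have /cvgrPdist_lt/(_ 1 ltr01) : (fun k => c * A' * rho ^+ k) @ \oo --> (0 : R).
    rewrite -[X in _ --> X](mulr0 (c * A')); apply: cvgMr.
    by apply: cvg_expr; rewrite ger0_norm // ltW.
  move=> [m _ /(_ m (leqnn m))] /=; rewrite sub0r normrN => /ltW/(le_trans (ler_norm _)).
  by exists m; rewrite mulrAC.
have /andP[r0 r1] := exp2N_lt1 g0.
have Wfin p : (p0 <= p)%N ->
    {ae P, forall w, (dyadic_energy Y (2 `^ (- g)) p w < +oo)%E}.
  move=> pp; apply: dyadic_energy_ae_fin => //.
  by apply: le_lt_trans (WA p pp) _; exact: ltry.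
pose S w := fine (dyadic_holder Y gamma w).
have S0 w : 0 <= S w by apply: fine_ge0; exact: dyadic_holder_ge0.
have mS : measurable_fun setT S.
  by apply: measurableT_comp => //; exact: measurable_dyadic_holder.
have Spow p w := @dyadic_holder_power_le _ _ _ _ _ Y g gamma L c rho m p w.
pose N : R := #|{: @grid_index n m.+2 * @grid_index n m.+2}|%:R + 2 * 4 ^+ n.
have N0 : 0 <= N by rewrite addr_ge0 // mulr_ge0 // exprn_ge0.
have Smom p : (p0 <= p)%N ->
    (\int[P]_w (S w ^+ p)%:E <= (N * (A * p%:R `^ iota) ^+ p)%:E)%E.
  move=> pp; have pgt0 : (0 < p)%N by exact: leq_trans pp.
  have x0 : 0 <= p%:R `^ iota :> R by exact: powR_ge0.
  have l0 : 0 <= (2 * L) ^+ p by rewrite exprn_ge0 // mulr_ge0.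
  have l1 : 0 <= (2 * (c * rho ^+ m)) ^+ p.
    by rewrite exprn_ge0 // !mulr_ge0 // exprn_ge0 // ltW.
  have m1 : measurable_fun setT (fun w =>
      ((2 * L) ^+ p)%:E * net_energy Y gamma m.+2 p w)%E.
    by apply: emeasurable_funM => //; exact: measurable_net_energy.
  have m2 : measurable_fun setT (fun w =>
      ((2 * (c * rho ^+ m)) ^+ p)%:E * dyadic_energy Y (2 `^ (- g)) p w)%E.
    by apply: emeasurable_funM => //; exact: measurable_dyadic_energy.
  have n1 w : setT w -> (0 <= ((2 * L) ^+ p)%:E * net_energy Y gamma m.+2 p w)%E.
    by move=> _; rewrite mule_ge0 ?lee_fin // net_energy_ge0.
  have n2 w : setT w -> (0 <= ((2 * (c * rho ^+ m)) ^+ p)%:E *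
      dyadic_energy Y (2 `^ (- g)) p w)%E.
    by move=> _; rewrite mule_ge0 ?lee_fin // dyadic_energy_ge0.
  apply: (@le_trans _ _ (\int[P]_w (((2 * L) ^+ p)%:E * net_energy Y gamma m.+2 p w +
    ((2 * (c * rho ^+ m)) ^+ p)%:E * dyadic_energy Y (2 `^ (- g)) p w))%E).
    apply: ae_ge0_le_integral => //.
    - by move=> w _; rewrite lee_fin exprn_ge0.
    - by apply/measurable_EFinP/measurable_funX.
    - by move=> w _; rewrite adde_ge0 ?n1 ?n2.
    - exact: emeasurable_funD.
    move: (Wfin p pp); apply: filterS => w Ww _.
    by have [] := Spow p w pgt0 g0 L0 c0 (ltW rho0) ts Ww.
  rewrite ge0_integralD // !ge0_integralZl //; first last.
  - by move=> w _; exact: net_energy_ge0.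
  - exact: measurable_net_energy.
  - by move=> w _; exact: dyadic_energy_ge0.
  - exact: measurable_dyadic_energy.
  have I1 := net_energy_moment (m.+2) C00 hcY K0 eps0 YK pgt0.
  have l0' : (0 <= ((2 * L) ^+ p)%:E)%E by rewrite lee_fin.
  have l1' : (0 <= ((2 * (c * rho ^+ m)) ^+ p)%:E)%E by rewrite lee_fin.
  apply: (le_trans (leeD (lee_wpmul2l l0' I1) (lee_wpmul2l l1' (WA p pp)))).
  rewrite -!EFinM -EFinD lee_fin -/A1 /N.
  have mulX (y z u v : R) : y ^+ p * (z * (u * v) ^+ p) = z * (y * u * v) ^+ p.
    by rewrite mulrCA -exprMn mulrA.
  rewrite !mulX [leRHS]mulrDl.
  apply: lerD; rewrite ler_wpM2l // ?mulr_ge0 ?exprn_ge0 //.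
    have y0 : 0 <= 2 * L * A1 by rewrite mulr_ge0 // mulr_ge0.
    apply: lerXn2r; rewrite ?nnegrE ?(mulr_ge0 (ltW A0) x0) ?(mulr_ge0 y0 x0) //.
    by rewrite ler_wpM2r // /A -mulrA ler_wpM2l // lerDl.
  have y1 : 0 <= 2 * (c * rho ^+ m) * A' by rewrite !mulr_ge0 // exprn_ge0 // ltW.
  apply: lerXn2r; rewrite ?nnegrE ?(mulr_ge0 (ltW A0) x0) ?(mulr_ge0 y1 x0) //.
  by rewrite ler_wpM2r // -mulrA /A ler_wpM2l // (le_trans cm) // lerDr mulr_ge0.
have [C CE] := @measurable_RV _ _ _ P _ _ S mS.
exists C; split.
  move: (Wfin p0 (leqnn _)) (holder_below_dyfloor_cvg a0 hY).
  apply: filterS2 => w Ww Yw; rewrite holder_constant_dyadic // CE /S fineK //.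
  by have [] := Spow p0 w p00 g0 L0 c0 (ltW rho0) ts Ww.
rewrite unlock; under eq_integral do rewrite CE.
exact: (exp_moment mS S0 i0 A0 N0 p00 Smom (ltW beta0) bA).
Qed.

End main.

Theorem proposition2p15 (R : realType) (n : nat) (C0 iota alpha : R)
    (n_ge1 : (1 <= n)%N) (C0_gt0 : 0 < C0) (iota_ge0 : 0 <= iota)
    (alpha_gt0 : 0 < alpha) :
  (forall (d : measure_display) (T : measurableType d) (P : probability T R)
      (X : 'rV[R]_n -> {RV P >-> R}),
    increments_L2 X -> hypercontractive X C0 iota ->
    ((exists Y : 'rV[R]_n -> {RV P >-> R},
        modification X Y /\ holder_below Y alpha) <->
     (forall eps : R, 0 < eps ->
        exists K : R, 0 < K /\ variance_bound X alpha eps K)))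
  /\
  (0 < iota ->
   forall eps K : R, 0 < eps -> 0 < K ->
   exists beta0 : R, 0 < beta0 /\
   forall beta : R, 0 < beta -> beta <= beta0 ->
   forall (d : measure_display) (T : measurableType d) (P : probability T R)
      (X Y : 'rV[R]_n -> {RV P >-> R}),
    increments_L2 X -> hypercontractive X C0 iota ->
    variance_bound X alpha eps K ->
    modification X Y -> holder_below Y alpha ->
    holder_constant_exp_moment Y (alpha - eps) iota beta).
Proof.
split=> [d T P X X2 hX|i0 eps K eps0 K0]; last exact: holder_exp_moment.
split=> [[Y [XY hY]] eps eps0|XK]; first exact: (holder_variance_bound C0_gt0 X2 hX XY hY).
exact: (kolmogorov_modification C0_gt0 alpha_gt0 hX XK).
Qed.
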